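(* Let $\mathbb J=\bigoplus_{\alpha\in\Pi^+}\mathbb J_\alpha$ be an invariant generalized almost complex structure on a maximal flag $\mathbb F$, and write $\Pi^+=\Theta_{nc}\sqcup\Theta_c$, where $\mathbb J_\alpha$ is of noncomplex type for all $\alpha\in\Theta_{nc}$ and of complex type for all $\alpha\in\Theta_c$. Then the invariant pure spinor line $K_{\mathcal L}\subset\bigwedge^\bullet(\mathfrak n^-)^\ast\otimes\mathbb C$ associated to $\mathbb J$ is generated by $$\varphi_{\mathcal L}=e^{\sum_{\alpha\in\Theta_{nc}}(B_\alpha+i\omega_\alpha)}\bigwedge_{\alpha\in\Theta_c}\Omega_\alpha,$$ where $B_\alpha=-\dfrac{a_\alpha}{x_\alpha}S_\alpha^\ast\wedge A_\alpha^\ast$ and $\omega_\alpha=-\dfrac{k_\alpha}{x_\alpha}\,\omega_{b_0}|_{\mathfrak u_\alpha}$ with $k_\alpha=\dfrac1{2i\langle H,H_\alpha\rangle}$ for all $\alpha\in\Theta_{nc}$, and $\Omega_\alpha\in\bigwedge^{1,0}\mathfrak u_\alpha^\ast$ defines a complex structure on $\mathfrak u_\alpha$ for all $\alpha\in\Theta_c$.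
   Context: Setting. $\mathfrak g$ is the Lie algebra of a complex semisimple Lie group $G$, $\mathfrak h\subset\mathfrak g$ a Cartan subalgebra, $\Pi$ the set of roots, $\Pi^+$ a choice of positive roots with simple system $\Sigma$, $\langle\cdot,\cdot\rangle$ the Cartan–Killing form, $H_\alpha\in\mathfrak h$ defined by $\alpha=\langle H_\alpha,\cdot\rangle$, $\mathfrak h_{\mathbb R}$ the real span of the $H_\alpha$, and $X_\alpha\in\mathfrak g_\alpha$ a Weyl basis ($\langle X_\alpha,X_{-\alpha}\rangle=1$, $[X_\alpha,X_\beta]=m_{\alpha,\beta}X_{\alpha+\beta}$ with $m_{\alpha,\beta}\in\mathbb R$, $m_{-\alpha,-\beta}=-m_{\alpha,\beta}$, and $m_{\alpha,\beta}=0$ if $\alpha+\beta$ is not a root). Put $A_\alpha=X_\alpha-X_{-\alpha}$, $S_\alpha=i(X_\alpha+X_{-\alpha})$, $\mathfrak u_\alpha=\mathrm{span}_{\mathbb R}\{A_\alpha,S_\alpha\}$. The compact real form is $\mathfrak u=i\mathfrak h_{\mathbb R}\oplus\bigoplus_{\alpha\in\Pi^+}\mathfrak u_\alpha$, with group $U=\exp\mathfrak u$ and maximal torus $T$, $\mathrm{Lie}(T)=\mathfrak t=i\mathfrak h_{\mathbb R}$. The maximal flag manifold is $\mathbb F=U/T$ with origin $b_0$, and $T_{b_0}\mathbb F=\mathfrak n^-:=\bigoplus_{\alpha\in\Pi^+}\mathfrak u_\alpha$. Fix a regular $H\in\mathfrak t$; $\omega_{b_0}(X,Y)=\langle H,[X,Y]\rangle$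 is the Kirillov–Kostant–Souriau (KKS) symplectic form at $b_0$, $k_\alpha=\frac1{2i\langle H,H_\alpha\rangle}$, and for $X\in\mathfrak u_\alpha$ put $X^\ast=k_\alpha\omega_{b_0}(X,\cdot)\in\mathfrak u_\alpha^\ast$; $(-S_\alpha^\ast,A_\alpha^\ast)$ is the basis dual to $(A_\alpha,S_\alpha)$. Generalized structures. $V\oplus V^\ast$ carries $\langle X+\xi,Y+\eta\rangle=\frac12(\xi(Y)+\eta(X))$. An invariant generalized almost complex structure on $\mathbb F$ is identified with its value at $b_0$, a map $\mathbb J$ on $\mathfrak n^-\oplus(\mathfrak n^-)^\ast$ that is an isometry, satisfies $\mathbb J^2=-1$ and commutes with the adjoint action of $T$. It splits as $\mathbb J=\bigoplus_{\alpha\in\Pi^+}\mathbb J_\alpha$, with $\mathbb J_\alpha$ on $\mathfrak u_\alpha\oplus\mathfrak u_\alpha^\ast$; in the basis $(A_\alpha,S_\alpha,-S_\alpha^\ast,A_\alpha^\ast)$, $\mathbb J_\alpha$ is either of complex type, $\pm\mathcal J_0$, or of noncomplex type, $\mathcal J_\alpha$, where $$\mathcal J_0=\begin{pmatrix}0&-1&0&0\\ 1&0&0&0\\ 0&0&0&-1\\ 0&0&1&0\end{pmatrix},\qquad \mathcal J_\alpha=\begin{pmatrix}a_\alpha&0&0&-x_\alpha\\ 0&a_\alpha&x_\alpha&0\\ 0&-y_\alpha&-a_\alpha&0\\ y_\alpha&0&0&-a_\alpha\end{pmatrix},\quad a_\alpha,x_\alpha,y_\alpha\in\mathbb R,\ a_\alpha^2=x_\alpha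 y_\alpha-1.$$ If $\mathbb J_\alpha=\pm\mathcal J_0$, the complex structure $I_\alpha$ on $\mathfrak u_\alpha$ determined by $\mathbb J_\alpha$ is the one with $\mathbb J_\alpha=\begin{pmatrix}-I_\alpha&0\\ 0&I_\alpha^\ast\end{pmatrix}$, and $\bigwedge^{1,0}\mathfrak u_\alpha^\ast$ consists of the complex 1-forms $\theta$ with $\theta(I_\alpha X)=i\theta(X)$. Matrix convention for 2-forms. On $\mathfrak u_\alpha$ the form $-bS_\alpha^\ast\wedge A_\alpha^\ast$ ($b\in\mathbb R$) is written as the matrix $B=\begin{pmatrix}0&b\\ -b&0\end{pmatrix}$, and $-\frac{k_\alpha}{x_\alpha}\omega_{b_0}|_{\mathfrak u_\alpha}$ as $\omega_\alpha=\begin{pmatrix}0&-1/x_\alpha\\ 1/x_\alpha&0\end{pmatrix}$; these matrices are the ones used as blocks in $e^B=\begin{pmatrix}1&0\\ B&1\end{pmatrix}$ and in the symplectic type structure $\begin{pmatrix}0&-\omega_\alpha^{-1}\\ \omega_\alpha&0\end{pmatrix}$. Spinors. $X+\xi$ acts on complex forms $\varphi$ by $(X+\xi)\cdot\varphi=i_X\varphi+\xi\wedge\varphi$. The pure spinor line associated to $\mathbb J$ is the complex line $K_{\mathcal L}$ of forms annihilated by the $+i$-eigenspace $\mathcal L$ of $\mathbb J$ in $(\mathfrak n^-\oplus(\mathfrak n^-)^\ast)\otimes\mathbb C$. For a complex 2-form $\beta$, $e^\beta=\sum_{j\ge0}\beta^j/j!$, acting by wedge product.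
   Formalization: With the usual wedge and first-slot contraction the printed exponent has the wrong sign; the formal theorem uses −(B_α+iω_α) in the exponential, i.e. the 2-forms whose contraction maps X↦i_X are given by the context's matrices for B_α and ω_α. *)

(* Defs.v *)
From HB Require Import structures.
From mathcomp Require Import all_boot all_order all_algebra.
From mathcomp Require Import complex.
From mathcomp Require Import classical_sets reals topology normedtype.

Set Implicit Arguments.
Unset Strict Implicit.
Unset Printing Implicit Defensive.

Import Order.TTheory GRing.Theory Num.Theory.
Import VectorInternalTheory numFieldNormedType.Exports.

Local Open Scope ring_scope.
Local Open Scope complex_scope.

(* Restriction of scalars of a finite dimensional complex vector space. *)
Definition realif (R : rcfType) (V : vectType R[i]) : Type := V.

Section Realification.
Variables (R : rcfType) (V : vectType R[i]).

HB.instance Definition _ := GRing.Zmodule.copy (realif V) V.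

Definition realif_scale (a : R) (v : realif V) : realif V := a%:C *: (v : V).

Fact realif_scaleA a b v :
  realif_scale a (realif_scale b v) = realif_scale (a * b) v.
Proof. by rewrite /realif_scale scalerA rmorphM. Qed.
Fact realif_scale1 : left_id 1 realif_scale.
Proof. by move=> v; rewrite /realif_scale rmorph1 scale1r. Qed.
Fact realif_scaleDr : right_distributive realif_scale +%R.
Proof. by move=> a u v; rewrite /realif_scale scalerDr. Qed.
Fact realif_scaleDl v : {morph realif_scale^~ v : a b / a + b}.
Proof. by move=> a b; rewrite /realif_scale rmorphD scalerDl. Qed.

HB.instance Definition _ := GRing.Zmodule_isLmodule.Build R (realif V)
  realif_scaleA realif_scale1 realif_scaleDr realif_scaleDl.

Fact realif_vect_iso : Vector.axiom (dim V + dim V) (realif V).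
Proof.
pose f (v : realif V) : 'rV[R]_(dim V + dim V) :=
  row_mx (map_mx (@complex.Re R) (v2r (v : V)))
         (map_mx (@complex.Im R) (v2r (v : V))).
pose h (r : 'rV[R]_(dim V + dim V)) : realif V :=
  r2v (\row_j (lsubmx r 0 j +i* rsubmx r 0 j)) : V.
exists f.
  move=> a u v; rewrite /f.
  have -> : v2r ((a *: u + v : realif V) : V)
            = a%:C *: v2r (u : V) + v2r (v : V) by rewrite -linearP.
  rewrite scale_row_mx add_row_mx; congr row_mx; apply/rowP => j; rewrite !mxE;
    by case: (v2r (u : V) 0 j) => p q; case: (v2r (v : V) 0 j) => r s;
       rewrite /= ?mul0r ?subr0 ?addr0.
exists h => [v | r].
  rewrite /h /f row_mxKl row_mxKr -[RHS](@v2rK _ V v); congr r2v.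
  by apply/rowP => j; rewrite !mxE; case: (v2r _ 0 j).
rewrite /f /h r2vK -[RHS]hsubmxK; congr row_mx; apply/rowP => j; by rewrite !mxE.
Qed.

HB.instance Definition _ :=
  Lmodule_hasFinDim.Build R (realif V) realif_vect_iso.

End Realification.

Section LieAlgebras.

Record lieAlg (K : fieldType) := LieAlg {
  lie_car :> vectType K;
  ad : 'Hom(lie_car, 'End(lie_car));
  ad_alternating : forall x, ad x x = 0;
  ad_jacobi : forall x y z,
    ad x (ad y z) + ad y (ad z x) + ad z (ad x y) = 0
}.

Variables (K : fieldType) (g : lieAlg K).

Definition lie_bracket (x y : g) : g := ad g x y.

Definition killing (x y : g) : K := \tr (f2mx (ad g x \o ad g y)%VF).

Definition lie_prod (A B : {vspace g}) : {vspace g} :=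
  <<[seq lie_bracket x y | x <- vbasis A, y <- vbasis B]>>%VS.

Definition lie_ideal (A : {vspace g}) : Prop :=
  (lie_prod fullv A <= A)%VS.

Definition lie_solvable (A : {vspace g}) : Prop :=
  exists n, iter n (fun B => lie_prod B B) A = 0%VS.

Definition lie_nilpotent (A : {vspace g}) : Prop :=
  exists n, iter n (lie_prod A) A = 0%VS.

Definition semisimple : Prop :=
  forall A : {vspace g}, lie_ideal A -> lie_solvable A -> A = 0%VS.

Definition cartan_subalgebra (h : {vspace g}) : Prop :=
  [/\ (lie_prod h h <= h)%VS, lie_nilpotent h &
      forall x, (forall y, y \in h -> lie_bracket x y \in h) -> x \in h].

Section Roots.
Variable h : {vspace g}.

Definition functional := 'Hom(subvs_of h, K^o).

Definition in_root_space (alpha : functional) (x : g) : Prop :=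
  forall z : subvs_of h, lie_bracket (vsval z) x = (alpha z : K) *: x.

Definition is_root (alpha : functional) : Prop :=
  alpha <> 0 /\ exists2 x, x <> 0 & in_root_space alpha x.

Definition positive_system (pos simple : seq functional) : Prop :=
  [/\ uniq pos,
      forall alpha, is_root alpha <-> (alpha \in pos) || (- alpha \in pos),
      forall alpha, alpha \in pos -> - alpha \notin pos,
      {subset simple <= pos} /\ free simple &
      forall alpha, alpha \in pos ->
        exists n : functional -> nat,
          alpha = \sum_(sigma <- simple) sigma *+ n sigma].

Definition dual_vectors (Hvec : functional -> g) : Prop :=
  forall alpha, Hvec alpha \in h /\
    forall z : subvs_of h, alpha z = killing (Hvec alpha) (vsval z).

End Roots.
End LieAlgebras.

Definition weyl_basis (R : realType) (g : lieAlg R[i]) (h : {vspace g})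
    (X : functional h -> g) (m : functional h -> functional h -> R) : Prop :=
  (forall alpha, is_root alpha ->
     in_root_space alpha (X alpha) /\ killing (X alpha) (X (- alpha)) = 1) /\
  forall alpha beta, is_root alpha -> is_root beta ->
    [/\ alpha + beta <> 0 ->
          lie_bracket (X alpha) (X beta)
          = (m alpha beta)%:C *: X (alpha + beta),
        m (- alpha) (- beta) = - m alpha beta &
        ~ is_root (alpha + beta) -> m alpha beta = 0].

Record flagDatum (R : realType) (g : lieAlg R[i]) := FlagDatum {
  cartan : {vspace g};
  cartanP : cartan_subalgebra cartan;
  pos : seq (functional cartan);
  simple : seq (functional cartan);
  posP : positive_system pos simple;
  Hvec : functional cartan -> g;
  HvecP : dual_vectors Hvec;
  Xvec : functional cartan -> g;
  weyl_m : functional cartan -> functional cartan -> R;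
  XvecP : weyl_basis Xvec weyl_m
}.

Arguments Hvec {R g} f alpha : rename.
Arguments Xvec {R g} f alpha : rename.

(* A complex form of mixed degree on a real vector space V: its homogeneous
   component of degree k is the restriction to lists of length k. *)
Definition form (R : realType) (V : vectType R) := seq V -> R[i].

Section Forms.
Variables (R : realType) (V : vectType R).
Implicit Types (phi psi beta : form V) (s : seq V).

Definition is_form phi : Prop :=
  (forall s1 s2 (a : R) (u v : V),
     phi (s1 ++ (a *: u + v) :: s2)
     = a%:C * phi (s1 ++ u :: s2) + phi (s1 ++ v :: s2)) /\
  (forall s1 s2 s3 (u : V), phi (s1 ++ u :: s2 ++ u :: s3) = 0).

Definition form_one : form V := fun s => (nilp s)%:R.

Definition form1 (theta : V -> R[i]) : form V :=
  fun s => if s is [:: X] then theta X else 0.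

Definition form2 (beta : V -> V -> R[i]) : form V :=
  fun s => if s is [:: X; Y] then beta X Y else 0.

Fixpoint shuffle_inv (m : bitseq) : nat :=
  if m is b :: m' then (if b then 0 else count id m') + shuffle_inv m' else 0.

(* Sum over (p, q)-shuffles, without factorials:
   (xi /\ eta)(X, Y) = xi X * eta Y - xi Y * eta X for covectors. *)
Definition wedge phi psi : form V := fun s =>
  \sum_(m : (size s).-tuple bool)
    (-1) ^+ shuffle_inv m * phi (mask m s) * psi (mask (map negb m) s).

(* For beta of degree 2, beta^j vanishes on s as soon as size s < 2 * j. *)
Definition form_exp beta : form V := fun s =>
  \sum_(j < (size s).+1) (j`!%:R)^-1 * iter j (wedge beta) form_one s.

Definition dual := 'Hom(V, R^o).

Definition covector (xi : dual) : form V := form1 (fun X => (xi X : R)%:C).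

Definition gen := (V * dual)%type.

Definition gen_pairing (u v : gen) : R :=
  2^-1 * ((u.2 v.1 : R) + (v.2 u.1 : R)).

Definition clifford (u : gen) phi : form V := fun s =>
  phi (u.1 :: s) + wedge (covector u.2) phi s.

Definition gen_almost_complex (J : 'End(gen)) : Prop :=
  (forall u v, gen_pairing (J u) (J v) = gen_pairing u v) /\
  (forall u, J (J u) = - u).

(* The pair (u, v) stands for u + i v in the complexification, so that
   J (u + i v) = i (u + i v) reads J u = - v and J v = u. *)
Definition in_eigenspace_i (J : 'End(gen)) (u v : gen) : Prop :=
  J u = - v /\ J v = u.

Definition pure_spinor_line (J : 'End(gen)) phi : Prop :=
  is_form phi /\
  forall u v, in_eigenspace_i J u v ->
    forall s, clifford u phi s + 'i * clifford v phi s = 0.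

Definition generates_line (K : form V -> Prop) phi : Prop :=
  (exists s, phi s <> 0) /\
  forall psi, K psi <-> exists c : R[i], psi = (fun s => c * phi s).

End Forms.

Definition mx_of_rows (R : realType) n (rows : seq (seq R)) : 'M[R]_n :=
  \matrix_(i, j) (nth [::] rows i)`_j.

Definition J0_mx (R : realType) : 'M[R]_4 := mx_of_rows 4
  [:: [:: 0; -1; 0;  0];
      [:: 1;  0; 0;  0];
      [:: 0;  0; 0; -1];
      [:: 0;  0; 1;  0]].

Definition Jnc_mx (R : realType) (a x y : R) : 'M[R]_4 := mx_of_rows 4
  [:: [:: a;   0;   0; - x];
      [:: 0;   a;   x;   0];
      [:: 0; - y; - a;   0];
      [:: y;   0;   0; - a]].

Section FlagManifold.
Variables (R : realType) (g : lieAlg R[i]) (F : flagDatum g).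
Notation root := (functional (cartan F)).
Notation X := (Xvec F).

Definition Avec (alpha : root) : realif g := X alpha - X (- alpha).
Definition Svec (alpha : root) : realif g :=
  'i *: (X alpha + X (- alpha)) : g.

Definition uspace (alpha : root) : {vspace realif g} :=
  <<[:: Avec alpha; Svec alpha]>>%VS.

Definition nminus : {vspace realif g} :=
  (\sum_(alpha <- pos F) uspace alpha)%VS.

Definition tangent := subvs_of nminus.

Definition Atan (alpha : root) : tangent := vsproj nminus (Avec alpha).
Definition Stan (alpha : root) : tangent := vsproj nminus (Svec alpha).

Definition roots : seq root := pos F ++ [seq - alpha | alpha <- pos F].

Definition hR : {vspace realif g} :=
  <<[seq (Hvec F alpha : realif g) | alpha <- roots]>>%VS.

Definition in_torus (Z : g) : Prop :=
  exists2 Y : g, (Y : realif g) \in hR & Z = 'i *: Y.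

Definition regular (Z : g) : Prop :=
  forall alpha : root, is_root alpha -> alpha (vsproj (cartan F) Z) <> 0.

(* Y = exp(ad Z) W: weak convergence is convergence, g being finite
   dimensional. *)
Definition is_exp_ad (Z W Y : g) : Prop :=
  forall l : 'Hom(g, R[i]^o),
    ((fun n => (l (\sum_(k < n) (k`!%:R)^-1 *: iter k (ad g Z) W) : R[i]^o))
       @ \oo --> (l Y : R[i]^o))%classic.

(* T is compact and connected, so T = exp(t) and Ad(T) = exp(ad t). *)
Definition is_AdT (f : 'End(tangent)) : Prop :=
  exists2 Z : g, in_torus Z &
    forall W : tangent, is_exp_ad Z (vsval W) (vsval (f W)).

Definition gen_act (f : 'End(tangent)) (u : gen tangent) : gen tangent :=
  (f u.1, (u.2 \o f^-1)%VF).

Definition invariant_gacs (J : 'End(gen tangent)) : Prop :=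
  gen_almost_complex J /\
  forall f, is_AdT f -> forall u, J (gen_act f u) = gen_act f (J u).

Section KKS.
Variable H : g.

(* The complex numbers <H, [X, Y]> and 1 / (2 i <H, H_alpha>) are real, for H
   in t and X, Y in the compact real form. *)
Definition kks (Y Z : tangent) : R :=
  complex.Re (killing H (lie_bracket (vsval Y : g) (vsval Z : g))).

Definition kcoef (alpha : root) : R :=
  complex.Re ((2 * 'i * killing H (Hvec F alpha))^-1).

Definition star (alpha : root) (Y : tangent) : dual tangent :=
  linfun (fun Z => kcoef alpha * kks Y Z : R^o).

Definition Astar (alpha : root) := star alpha (Atan alpha).
Definition Sstar (alpha : root) := star alpha (Stan alpha).

Definition frame (alpha : root) (j : 'I_2) : tangent :=
  nth 0 [:: Atan alpha; Stan alpha] j.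

Definition coframe (alpha : root) (j : 'I_2) : dual tangent :=
  nth 0 [:: - Sstar alpha; Astar alpha] j.

Definition gen_frame (alpha : root) (j : 'I_4) : gen tangent :=
  nth 0 [:: (Atan alpha, 0); (Stan alpha, 0);
            (0, - Sstar alpha); (0, Astar alpha)] j.

Definition has_block (J : 'End(gen tangent)) (alpha : root) (M : 'M[R]_4) :=
  forall j, J (gen_frame alpha j) = \sum_i M i j *: gen_frame alpha i.

Definition complex_type (J : 'End(gen tangent)) (alpha : root) : Prop :=
  has_block J alpha (J0_mx R) \/ has_block J alpha (- J0_mx R).

Definition noncomplex_type (J : 'End(gen tangent)) (alpha : root)
    (a x y : R) : Prop :=
  a ^+ 2 = x * y - 1 /\ has_block J alpha (Jnc_mx a x y).

(* The upper left block of a J_alpha of complex type is - I_alpha. *)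
Definition cpx_struct (J : 'End(gen tangent)) (Y : tangent) : tangent :=
  - (J (Y, 0)).1.

(* Nonzero elements of the (1,0) part of the dual of u_alpha, a subspace of
   the dual of n^- through the decomposition n^- = sum of the u_beta. *)
Definition is_form10 (J : 'End(gen tangent)) (alpha : root)
    (theta : tangent -> R[i]) : Prop :=
  [/\ forall (a : R) Y Z, theta (a *: Y + Z) = a%:C * theta Y + theta Z,
      forall beta Y, beta \in pos F -> beta != alpha ->
        vsval Y \in uspace beta -> theta Y = 0,
      forall Y, vsval Y \in uspace alpha ->
        theta (cpx_struct J Y) = 'i * theta Y &
      exists Y, theta Y <> 0].

Definition Bform (alpha : root) (a x : R) : form tangent := fun s =>
  (- (a / x))%:C * wedge (covector (Sstar alpha)) (covector (Astar alpha)) s.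

(* Only its restriction to u_alpha is used, see gram_mx. *)
Definition omegaform (alpha : root) (x : R) : form tangent :=
  form2 (fun Y Z => (- (kcoef alpha / x) * kks Y Z)%:C).

(* The matrix by which a 2-form on u_alpha is written: for
   - b S_alpha^* /\ A_alpha^* it is [0 b; -b 0], and for omegaform alpha x it
   is [0 -1/x; 1/x 0]. *)
Definition gram_mx (alpha : root) (beta : form tangent) : 'M[R[i]]_2 :=
  \matrix_(i, j) beta [:: frame alpha i; frame alpha j].

(* The element of the exterior square whose contraction map
   Y |-> i_Y beta, u_alpha -> u_alpha^*, has matrix M, acting on columns, in
   the bases (A_alpha, S_alpha) and (- S_alpha^*, A_alpha^* ); this is how M
   enters as a block of [1 0; M 1] and [0 -M^-1; M 0]. For M = gram_mx alpha
   beta, column j of M is beta (_, e_j), whereas i_{e_j} beta is beta (e_j, _):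
   a 2-form written by a matrix thus acts on spinors as the opposite of the
   alternating map with that Gram matrix. *)
Definition block_form (alpha : root) (M : 'M[R[i]]_2) : form tangent :=
  form2 (fun Y Z => \sum_i \sum_j
    M i j * (coframe alpha j Y : R)%:C * (coframe alpha i Z : R)%:C).

Definition spinor (Tnc Tc : seq root) (a x : root -> R)
    (Omega : root -> tangent -> R[i]) : form tangent :=
  wedge
    (form_exp (fun s => \sum_(alpha <- Tnc)
       (block_form alpha (gram_mx alpha (Bform alpha (a alpha) (x alpha))) s +
        'i * block_form alpha (gram_mx alpha (omegaform alpha (x alpha))) s)))
    (\big[@wedge R tangent/@form_one R tangent]_(alpha <- Tc)
       form1 (Omega alpha)).

End KKS.
End FlagManifold.

(* Main.v *)
From HB Require Import structures.
From mathcomp Require Import all_boot all_order all_algebra.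
From mathcomp Require Import complex boolp.
From mathcomp Require Import reals ring.
Require Import Defs.

Set Implicit Arguments.
Unset Strict Implicit.
Unset Printing Implicit Defensive.

Import Order.TTheory GRing.Theory Num.Theory VectorInternalTheory.

Local Open Scope ring_scope.
Local Open Scope complex_scope.

(** The +i-eigenspace of J consists of the vectors u - i J u, a condition that
    is real-linear in u, so a form psi lies on the spinor line as soon as
    (u - i J u) . psi = 0 for the vectors u of the frame made of the A_alpha,
    S_alpha and their duals ([pure_spinor_lineE], [gen_induction]). Read in one
    block, this says:
    - for alpha noncomplex, i_X psi = (i_X beta) /\ psi for X = A_alpha and
      X = S_alpha, where beta = B_alpha + i omega_alpha
      ([noncomplex_condition]);
    - for alpha complex, i_X psi = theta(X)/theta(A_alpha) i_{A_alpha} psi for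
      X in u_alpha and theta /\ psi = 0, where theta = Omega_alpha is a
      (1,0)-form ([complex_condition]).
    Hence the spinor line is the solution set of the system
    [spinor_equations], in which no Lie algebra is left ([spinor_conditionsE]).

    This system has a one-dimensional solution space ([spinor_line]). Since
    i_X e^beta = (i_X beta) /\ e^beta ([contract_exp]), the announced form
    satisfies it. Conversely, contracting theta /\ psi = 0 with A_alpha gives
    theta(A_alpha) psi = theta /\ i_{A_alpha} psi, and i_{A_alpha} psi solves
    the same system with alpha dropped from the complex roots; when no complex
    root remains, i_X psi = (i_X beta) /\ psi for all X, and this recursion
    determines psi from its component of degree 0, as a multiple of e^beta.

    What ties the two halves is that the -S_alpha^*, A_alpha^* really are the
    basis dual to the A_alpha, S_alpha ([coframe_frame]). Different roots are
    orthogonal for the form omega by invariance of the Killing form, and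
    omega(A_alpha, S_alpha) = 2 i alpha(H) up to taking a real part. The
    duality thus amounts to alpha(H) being purely imaginary and nonzero, that
    is, to the numbers alpha(H_beta) being real ([killing_Hvec_real]). This
    comes from the sl2-triple of alpha: the eigenvalues of ad H_alpha are
    integral multiples of t/2, where t = alpha(H_alpha), while t is also the
    trace of (ad H_alpha)^2, so that t = n (t/2)^2 with n an integer. *)

(** * Contraction and exterior product *)

Section Wedge.
Variables (R : realType) (V : vectType R).
Local Notation one_form := (@form_one R V).
Implicit Types (phi psi chi : form V) (s : seq V) (theta eta : V -> R[i]).

Definition contract (X : V) phi : form V := fun s => phi (X :: s).

(** The main automorphism of the exterior algebra, (-1)^k in degree k: it
    carries the sign of the antiderivation rule in all degrees at once. *)
Definition parity phi : form V := fun s => (-1) ^+ size s * phi s.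

Lemma wedge_nil phi psi : wedge phi psi [::] = phi [::] * psi [::].
Proof.
rewrite /wedge (big_pred1 [tuple]) => [|m]; first by rewrite /= mul1r.
by apply/esym/eqP; rewrite [LHS]tuple0.
Qed.

(** The antiderivation rule for i_X. Shuffles of X :: s are sorted by the
    factor that receives X; giving it to the right factor moves it past all
    entries of the left one. Together with [wedge_nil] this determines the
    product, and it reduces every identity on wedge to an induction on the
    list of arguments. *)
Lemma wedge_cons phi psi X s :
  wedge phi psi (X :: s)
  = wedge (contract X phi) psi s + wedge (parity phi) (contract X psi) s.
Proof.
rewrite /wedge /=.
pose h (p : bool * (size s).-tuple bool) : (size s).+1.-tuple bool :=
  [tuple of p.1 :: p.2].
pose h' (m : (size s).+1.-tuple bool) := (thead m, [tuple of behead m]).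
have hK : cancel h h'.
  by move=> [b m]; congr pair; apply: val_inj.
have h'K : cancel h' h by move=> m; rewrite /h /= -tuple_eta.
rewrite (reindex h) /=; last by exists h' => ? _; rewrite ?hK ?h'K.
rewrite -(pair_bigA _ (fun b (m : (size s).-tuple bool) =>
  (-1) ^+ ((if b then 0 else count id m) + shuffle_inv m)%N
     * phi (mask (b :: m) (X :: s)) *
  psi (mask (map negb (b :: m)) (X :: s)))) /=.
rewrite (bigD1 true) //= (big_pred1 false) => [|[]//].
congr (_ + _); apply: eq_bigr => m _ //=.
rewrite /parity /contract size_mask ?size_tuple //; congr (_ * _).
by rewrite exprD mulrA [_ * (-1) ^+ count _ _]mulrC.
Qed.

Lemma wedge_sumr (I : Type) (r : seq I) phi (c : I -> R[i])
    (f : I -> form V) s :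
  wedge phi (fun t => \sum_(i <- r) c i * f i t) s
  = \sum_(i <- r) c i * wedge phi (f i) s.
Proof.
rewrite /wedge; under [RHS]eq_bigr do rewrite mulr_sumr.
rewrite exchange_big; apply: eq_bigr => m _.
by rewrite mulr_sumr; apply: eq_bigr => i _; ring.
Qed.

Lemma wedge_linearl c phi phi' psi s :
  wedge (fun t => c * phi t + phi' t) psi s
  = c * wedge phi psi s + wedge phi' psi s.
Proof.
rewrite /wedge mulr_sumr -big_split; apply: eq_bigr => m _ /=; ring.
Qed.

Lemma wedge_linearr c phi psi psi' s :
  wedge phi (fun t => c * psi t + psi' t) s
  = c * wedge phi psi s + wedge phi psi' s.
Proof.
rewrite /wedge mulr_sumr -big_split; apply: eq_bigr => m _ /=; ring.
Qed.

Lemma wedgeZl c phi psi s :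
  wedge (fun t => c * phi t) psi s = c * wedge phi psi s.
Proof. by rewrite /wedge mulr_sumr; apply: eq_bigr => m _ /=; ring. Qed.

Lemma wedgeZr c phi psi s :
  wedge phi (fun t => c * psi t) s = c * wedge phi psi s.
Proof. by rewrite /wedge mulr_sumr; apply: eq_bigr => m _ /=; ring. Qed.

Lemma wedgeDl phi phi' psi s :
  wedge (fun t => phi t + phi' t) psi s = wedge phi psi s + wedge phi' psi s.
Proof. by rewrite /wedge -big_split; apply: eq_bigr => m _ /=; ring. Qed.

Lemma wedgeDr phi psi psi' s :
  wedge phi (fun t => psi t + psi' t) s = wedge phi psi s + wedge phi psi' s.
Proof. by rewrite /wedge -big_split; apply: eq_bigr => m _ /=; ring. Qed.

Lemma wedge0l psi s : wedge (fun _ => 0) psi s = 0.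
Proof. by rewrite /wedge big1 // => m _; rewrite mulr0 mul0r. Qed.

Lemma wedge0r phi s : wedge phi (fun _ => 0) s = 0.
Proof. by rewrite /wedge big1 // => m _; rewrite mulr0. Qed.

Lemma parityK phi : parity (parity phi) = phi.
Proof. by apply/funext => s; rewrite /parity mulrA -expr2 sqrr_sign mul1r. Qed.

Lemma contract_parity X phi :
  contract X (parity phi) = fun s => -1 * parity (contract X phi) s.
Proof. by apply/funext => s; rewrite /contract /parity /= exprS mulrA. Qed.

Lemma contract_wedge X phi psi :
  contract X (wedge phi psi)
  = fun s => wedge (contract X phi) psi s + wedge (parity phi) (contract X psi) s.
Proof. by apply/funext => s; rewrite /contract wedge_cons. Qed.

Lemma contract_one X : contract X one_form = fun _ => 0.
Proof. by []. Qed.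

Lemma contract_form1 X theta :
  contract X (form1 theta) = fun s => theta X * one_form s.
Proof. by apply/funext => -[|Y s]; rewrite /contract /form_one /= ?mulr1 ?mulr0. Qed.

Lemma parity_one : parity one_form = one_form.
Proof.
by apply/funext => -[|X s]; rewrite /parity /form_one ?mulr0 //= mul1r.
Qed.

Lemma parity_form1 theta : parity (form1 theta) = fun s => -1 * form1 theta s.
Proof. by apply/funext => -[|X [|Y s]]; rewrite /parity /= ?mulr0. Qed.

Lemma parity_form2 (b : V -> V -> R[i]) : parity (form2 b) = form2 b.
Proof.
by apply/funext => -[|X [|Y [|Z s]]]; rewrite /parity /= ?mulr0 // sqrrN expr1n mul1r.
Qed.

Lemma parity_wedge phi psi :
  parity (wedge phi psi) = wedge (parity phi) (parity psi).
Proof.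
apply/funext => s; elim: s phi psi => [|X s IH] phi psi.
  by rewrite /parity !wedge_nil /= !mul1r.
rewrite wedge_cons !contract_parity wedgeZl wedgeZr -!IH.
by rewrite /parity wedge_cons /= exprS; ring.
Qed.

Lemma wedgeA phi psi chi :
  wedge (wedge phi psi) chi = wedge phi (wedge psi chi).
Proof.
apply/funext => s; elim: s phi psi chi => [|X s IH] phi psi chi.
  by rewrite !wedge_nil mulrA.
rewrite !(wedge_cons _ _ X) !contract_wedge wedgeDl wedgeDr parity_wedge !IH.
by rewrite addrA.
Qed.

Lemma wedge1l phi : wedge one_form phi = phi.
Proof.
apply/funext => s; elim: s phi => [|X s IH] phi; first by rewrite wedge_nil mul1r.
by rewrite wedge_cons contract_one wedge0l add0r parity_one IH.
Qed.

Lemma wedge1r phi : wedge phi one_form = phi.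
Proof.
apply/funext => s; elim: s phi => [|X s IH] phi; first by rewrite wedge_nil mulr1.
by rewrite wedge_cons contract_one wedge0r addr0 IH.
Qed.

Lemma wedge_form1_cons theta phi X s :
  wedge (form1 theta) phi (X :: s)
  = theta X * phi s - wedge (form1 theta) (contract X phi) s.
Proof.
by rewrite wedge_cons contract_form1 wedgeZl wedge1l parity_form1 wedgeZl mulN1r.
Qed.

Lemma wedge_form1_form1 theta eta Y Z :
  wedge (form1 theta) (form1 eta) [:: Y; Z] = theta Y * eta Z - eta Y * theta Z.
Proof. by rewrite wedge_form1_cons contract_form1 wedgeZr wedge1r. Qed.

(** Both sides obey the antiderivation rule with the same contractions. *)
Lemma wedge_form1C theta phi :
  wedge (form1 theta) phi = wedge (parity phi) (form1 theta).
Proof.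
apply/funext => s; elim: s phi => [|X s IH] phi.
  by rewrite !wedge_nil /= mul0r mulr0.
rewrite wedge_form1_cons wedge_cons contract_form1 wedgeZr parityK wedge1r.
by rewrite contract_parity wedgeZl -IH; ring.
Qed.

Lemma wedge_form1_sq theta s : wedge (form1 theta) (form1 theta) s = 0.
Proof.
case: s => [|X s]; first by rewrite wedge_nil /= mul0r.
by rewrite wedge_form1_cons contract_form1 wedgeZr wedge1r subrr.
Qed.

Lemma wedge_cons2 phi psi u v s :
  wedge phi psi (u :: v :: s)
  = wedge (contract v (contract u phi)) psi s
    + wedge (parity (contract u phi)) (contract v psi) s
    - wedge (parity (contract v phi)) (contract u psi) s
    + wedge phi (contract v (contract u psi)) s.
Proof.
rewrite wedge_cons !(wedge_cons _ _ v) contract_parity wedgeZl parityK.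
ring.
Qed.

Lemma form_ext_linear phi a u v : is_form phi ->
  contract (a *: u + v) phi = fun s => a%:C * contract u phi s + contract v phi s.
Proof. by move=> [phiL _]; apply/funext => s; apply: (phiL [::]). Qed.

Lemma form_contract X phi : is_form phi -> is_form (contract X phi).
Proof.
move=> [phiL phiA]; split=> [s1 s2 a u v|s1 s2 s3 u].
  exact: (phiL (X :: s1)).
exact: (phiA (X :: s1)).
Qed.

Lemma form_contract_sq X phi : is_form phi ->
  contract X (contract X phi) = fun _ => 0.
Proof. by move=> [_ phiA]; apply/funext => s; apply: (phiA [::] [::]). Qed.

(** Polarization of i_X i_X = 0 at X + Y. *)
Lemma form_contractC X Y phi : is_form phi ->
  contract X (contract Y phi) = fun s => - contract Y (contract X phi) s.
Proof.
move=> phiF; apply/funext => s; apply/eqP; rewrite -addr_eq0; apply/eqP.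
have /(congr1 (fun f => f s)) := form_contract_sq (1 *: X + Y) phiF.
rewrite (form_ext_linear _ _ _ phiF) /contract /=.
have [phiL _] := phiF.
rewrite (phiL [:: X]) (phiL [:: Y]) /=.
have /(congr1 (fun f => f s)) := form_contract_sq X phiF.
have /(congr1 (fun f => f s)) := form_contract_sq Y phiF.
rewrite /contract /= => -> ->; rewrite !rmorph1 => <-; ring.
Qed.

Lemma form_parity phi : is_form phi -> is_form (parity phi).
Proof.
move=> [phiL phiA]; split=> [s1 s2 a u v|s1 s2 s3 u].
  by rewrite /parity phiL !size_cat /=; ring.
by rewrite /parity phiA mulr0.
Qed.

(** In the alternating part, a repeated argument at the head is handled by
    [wedge_cons2], whose mixed terms cancel; if the two copies are apart, the
    first one is moved to the right by antisymmetry in the first two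
    arguments. *)
Lemma form_wedge phi psi : is_form phi -> is_form psi -> is_form (wedge phi psi).
Proof.
move=> phiF psiF; split=> [s1 s2 a u v|s1 s2 s3 u].
  elim: s1 phi psi phiF psiF => [|X s1 IH] phi psi phiF psiF /=.
    rewrite !wedge_cons !form_ext_linear // wedge_linearl wedge_linearr; ring.
  rewrite !(wedge_cons _ _ X) !IH //; try ring;
    by [apply: form_contract | apply: form_parity].
elim: s1 phi psi phiF psiF => [|X s1 IH] phi psi phiF psiF /=; last first.
  by rewrite wedge_cons !IH ?addr0 //; [apply: form_parity | apply: form_contract..].
elim: s2 phi psi phiF psiF => [|v s2 IH] phi psi phiF psiF /=.
  by rewrite wedge_cons2 !form_contract_sq // wedge0l wedge0r; ring.
have -> : forall s, wedge phi psi (u :: v :: s) = - wedge phi psi (v :: u :: s).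
  move=> s; rewrite !wedge_cons2 !(form_contractC v u) //.
  rewrite -[X in wedge phi X](_ : (fun t => -1 * contract u (contract v psi) t) = _);
    last by apply/funext => t; rewrite mulN1r.
  rewrite -[X in wedge X psi](_ : (fun t => -1 * contract u (contract v phi) t) = _);
    last by apply/funext => t; rewrite mulN1r.
  by rewrite wedgeZl wedgeZr; ring.
by rewrite wedge_cons !IH ?addr0 ?oppr0 //;
  [apply: form_parity | apply: form_contract..].
Qed.

Lemma form_oneP : is_form one_form.
Proof.
by split=> [s1 s2 a u v|s1 s2 s3 u]; case: s1 => //=; rewrite /form_one /= mulr0 addr0.
Qed.

Lemma form1P theta : (forall a u v, theta (a *: u + v) = a%:C * theta u + theta v) ->
  is_form (form1 theta).
Proof.
move=> thetaL; split=> [s1 s2 a u v|s1 s2 s3 u].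
  case: s1 => [|X [|Y s1]] /=; last by rewrite mulr0 addr0.
    by case: s2 => [|Y s2]; rewrite /= ?thetaL // mulr0 addr0.
  by rewrite mulr0 addr0.
by case: s1 => [|X [|Y s1]] //=; case: s2.
Qed.

Lemma form2P (b : V -> V -> R[i]) :
  (forall a u v w, b (a *: u + v) w = a%:C * b u w + b v w) ->
  (forall a u v w, b w (a *: u + v) = a%:C * b w u + b w v) ->
  (forall u, b u u = 0) -> is_form (form2 b).
Proof.
move=> bL bR bA; split=> [s1 s2 a u v|s1 s2 s3 u].
  case: s1 => [|X [|Y [|Z s1]]] /=; rewrite ?mulr0 ?addr0 //.
    by case: s2 => [|Y [|Z s2]]; rewrite /= ?bL ?mulr0 ?addr0.
  by case: s2 => [|Z s2]; rewrite /= ?bR ?mulr0 ?addr0.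
case: s1 => [|X [|Y s1]] /=; [|by case: s2|by case: s1].
case: s2 => [|Z s2]; last by case: s2.
by case: s3 => [|W s3] //=; rewrite bA.
Qed.

Lemma form_scale c phi : is_form phi -> is_form (fun s => c * phi s).
Proof.
move=> [phiL phiA]; split=> [s1 s2 a u v|s1 s2 s3 u]; first by rewrite phiL; ring.
by rewrite phiA mulr0.
Qed.

End Wedge.

(** * The exponential of a 2-form *)

Section Exponential.
Variables (R : realType) (V : vectType R).
Local Notation one_form := (@form_one R V).
Implicit Types (phi psi : form V) (s : seq V).

(** The factors of a product are evaluated on sublists only; this is what
    allows truncated exponentials and inductions on degree. *)
Lemma eq_wedge_size phi psi psi' s :
  (forall t, (size t <= size s)%N -> psi t = psi' t) ->
  wedge phi psi s = wedge phi psi' s.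
Proof.
move=> eq_psi; apply: eq_bigr => m _; rewrite eq_psi //.
exact/size_subseq/mask_subseq.
Qed.

Variable b : V -> V -> R[i].
Local Notation beta := (form2 b).
Local Notation pow j := (iter j (wedge beta) one_form).

Lemma form2_pow_eq0 j s : (size s < j)%N -> pow j s = 0.
Proof.
elim: j s => [//|j IH] s lt_s_j /=; rewrite /wedge big1 // => m _.
have [sz2|] := eqVneq (size (mask m s)) 2%N; last first.
  by case: (mask m s) => [|X [|Y [|Z t]]] // _; rewrite mulr0 mul0r.
rewrite IH ?mulr0 //.
have := count_predC id m; rewrite size_tuple -(size_mask (size_tuple m)) sz2.
rewrite size_mask ?size_map ?size_tuple // count_map.
rewrite (eq_count (a2 := predC id)) // => sz_s.
by rewrite -(ltn_add2l 2%N) sz_s (leq_trans lt_s_j) // addSn addnS ltnS leqnSn.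
Qed.

(** Any longer truncation of the exponential series has the same value, so a
    single bound serves for all the sublists met in a product. *)
Lemma form_expE N s : (size s < N)%N ->
  form_exp beta s = \sum_(j < N) (j`!%:R)^-1 * pow j s.
Proof.
move=> lt_s_N; rewrite /form_exp.
rewrite (big_ord_widen N (fun j => (j`!%:R)^-1 * pow j s)) //.
rewrite [RHS](bigID (fun j : 'I_N => (j < (size s).+1)%N)) /=.
rewrite [X in _ = _ + X]big1 ?addr0 // => j; rewrite -leqNgt => lt_s_j.
by rewrite form2_pow_eq0 ?mulr0.
Qed.

Lemma contract_form2 X : contract X beta = form1 (b X).
Proof. by apply/funext => -[|Y [|Z s]]. Qed.

Lemma wedge_form2C theta phi :
  wedge beta (wedge (form1 theta) phi) = wedge (form1 theta) (wedge beta phi).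
Proof. by rewrite -!wedgeA wedge_form1C parity_form2. Qed.

(** Derivation of a power: form2 b has even degree, so it commutes with the
    1-form i_X beta. *)
Lemma contract_pow X j :
  contract X (pow j.+1)
  = fun s => (j.+1)%:R * wedge (form1 (b X)) (pow j) s.
Proof.
elim: j => [|j IH].
  rewrite iterS contract_wedge contract_form2; apply/funext => s.
  by rewrite contract_one wedge0r addr0 mul1r.
rewrite iterS contract_wedge contract_form2 IH parity_form2; apply/funext => s.
by rewrite wedgeZr wedge_form2C -iterS [in RHS]mulrSr mulrDl mul1r addrC.
Qed.

Lemma exp_nil : form_exp beta [::] = 1.
Proof. by rewrite /form_exp /= big_ord1 /= invr1 mul1r. Qed.

Lemma contract_exp X :
  contract X (form_exp beta) = wedge (form1 (b X)) (form_exp beta).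
Proof.
apply/funext => s; rewrite /contract (@form_expE (size s).+2) //.
rewrite big_ord_recl [pow _ _]/= mulr0 add0r.
rewrite (@eq_wedge_size _ _ (
  fun t => \sum_(j < (size s).+1) (j`!%:R)^-1 * pow j t)); last first.
  by move=> t le_t_s; apply: form_expE.
rewrite wedge_sumr; apply: eq_bigr => j _; rewrite lift0.
rewrite -[pow _ (X :: s)]/(contract X (pow j.+1) s) contract_pow factS natrM.
by rewrite invfM mulrACA mulVf ?mul1r // pnatr_eq0.
Qed.

Lemma parity_exp : parity (form_exp beta) = form_exp beta.
Proof.
apply/funext => s; rewrite /parity /form_exp mulr_sumr; apply: eq_bigr => j _.
rewrite mulrCA; congr (_ * _).
suff /(congr1 (fun f => f s)) : parity (pow j) = pow j by [].
elim: (nat_of_ord j) => [|k IH]; first exact: parity_one.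
by rewrite iterS parity_wedge parity_form2 IH.
Qed.

Lemma form_expP : is_form beta -> is_form (form_exp beta).
Proof.
move=> betaF; have powF j : is_form (pow j).
  by elim: j => [|j IH]; [apply: form_oneP | apply: form_wedge].
split=> [s1 s2 a u v|s1 s2 s3 u]; last first.
  by rewrite /form_exp big1 // => j _; rewrite (powF j).2 mulr0.
rewrite /form_exp !size_cat /= mulr_sumr -big_split; apply: eq_bigr => j _ /=.
rewrite (powF j).1; ring.
Qed.

(** The equation computes psi (X :: s) from values of psi on sublists of s. *)
Lemma exp_unique psi :
  (forall X, contract X psi = wedge (form1 (b X)) psi) ->
  psi = fun s => psi [::] * form_exp beta s.
Proof.
move=> psiE; apply/funext => s.
have [n] := ubnP (size s); elim: n s => // n IH [|X s] lt_s_n.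
  by rewrite exp_nil mulr1.
rewrite -[psi _]/(contract X psi s) -[form_exp _ _]/(contract X (form_exp beta) s).
rewrite psiE contract_exp -wedgeZr; apply: eq_wedge_size => t le_t_s; apply: IH.
exact: leq_ltn_trans le_t_s _.
Qed.

End Exponential.

(** * A linear system with a one-dimensional space of solutions *)

Section SpinorLine.
Variables (R : realType) (V : vectType R) (I : eqType).
Variables (b : V -> V -> R[i]) (theta : I -> V -> R[i]) (E : I -> V).
Implicit Types (phi psi : form V) (T : seq I) (s : seq V).

Local Notation beta := (form2 b).
Local Notation Omega T :=
  (\big[@wedge R V/@form_one R V]_(k <- T) form1 (theta k)).

(** The vectors E k are dual to the 1-forms theta k up to nonzero factors, and
    they lie in the kernel of the 2-form b. *)
Definition adapted T :=
  [/\ uniq T,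
      {in T, forall k a u v, theta k (a *: u + v) = a%:C * theta k u + theta k v},
      {in T, forall k, theta k (E k) != 0},
      {in T &, forall j k, j != k -> theta j (E k) = 0} &
      {in T, forall k X, b X (E k) = 0 /\ b (E k) X = 0}].

Lemma adapted_cons k T : adapted (k :: T) -> adapted T.
Proof.
have sT : {subset T <= k :: T} by move=> j jT; rewrite inE jT orbT.
case=> [/= /andP[_ uT] tL t0 t1 bE]; split=> //.
- by move=> j /sT; apply: tL.
- by move=> j /sT; apply: t0.
- by move=> i j /sT iT /sT; apply: t1.
- by move=> j /sT; apply: bE.
Qed.

Lemma adapted_head k T : adapted (k :: T) ->
  [/\ k \notin T, theta k (E k) != 0,
      forall j, j \in T -> theta j (E k) = 0 /\ theta k (E j) = 0 &
      forall X, b X (E k) = 0 /\ b (E k) X = 0].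
Proof.
case=> [/= /andP[kT uT] tL t0 t1 bE]; have kk : k \in k :: T := mem_head _ _.
split=> //; [exact: t0 | | exact: bE].
move=> j jT; have jk : j \in k :: T by rewrite inE jT orbT.
have neq_jk : j != k by apply: contraNneq kT => <-.
by split; apply: t1 => //; rewrite eq_sym.
Qed.

(** By the second condition, i_X psi - (i_X b) /\ psi only depends on X through
    the values theta k X; the third one is annihilation by the theta k. *)
Definition spinor_equations T psi : Prop :=
  [/\ is_form psi,
      forall X, contract X psi = fun s => wedge (form1 (b X)) psi s +
        \sum_(k <- T) theta k X / theta k (E k) * contract (E k) psi s &
      {in T, forall k, wedge (form1 (theta k)) psi = fun _ => 0}].

Lemma spinor_equations_scale T c psi : spinor_equations T psi ->
  spinor_equations T (fun s => c * psi s).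
Proof.
case=> [psiF psiC psiW]; split=> [|X|k kT]; first exact: form_scale.
  apply/funext => s; rewrite wedgeZr /contract.
  rewrite -[psi _]/(contract X psi s) psiC mulrDr mulr_sumr; congr (_ + _).
  by apply: eq_bigr => k _; rewrite mulrCA.
by apply/funext => s; rewrite wedgeZr psiW // mulr0.
Qed.

Lemma form1_0 : form1 (fun=> 0) = (fun=> 0) :> form V.
Proof. by apply/funext => -[|X [|Y s]]. Qed.

Lemma contract_Omega_cons k T X :
  contract X (Omega (k :: T))
  = fun s => theta k X * Omega T s - wedge (form1 (theta k)) (contract X (Omega T)) s.
Proof. by apply/funext => s; rewrite big_cons /contract wedge_form1_cons. Qed.

Lemma contract_Omega_E k T : adapted (k :: T) -> contract (E k) (Omega T) = fun=> 0.
Proof.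
move=> adkT; have [_ _ tE _] := adapted_head adkT.
elim: T {adkT} tE => [|j T IH] tE; first by rewrite big_nil.
rewrite contract_Omega_cons IH => [|i iT]; last by apply: tE; rewrite inE iT orbT.
by apply/funext => s; rewrite (tE j _).1 ?mem_head // mul0r wedge0r subr0.
Qed.

(** The product of the theta k only depends on its arguments through the
    theta k, hence is differentiated through the E k. *)
Lemma contract_Omega T X : adapted T ->
  contract X (Omega T)
  = fun s => \sum_(k <- T) theta k X / theta k (E k) * contract (E k) (Omega T) s.
Proof.
elim: T => [|k T IH] adT; first by apply/funext => s; rewrite !big_nil.
have [_ tk0 tE _] := adapted_head adT.
apply/funext => s; rewrite contract_Omega_cons [RHS]big_cons.
rewrite contract_Omega_cons contract_Omega_E // wedge0r.
rewrite subr0 mulrA divfK //; congr (_ + _).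
rewrite (IH (adapted_cons adT)) wedge_sumr -sumrN.
apply: eq_big_seq => j jT; rewrite contract_Omega_cons (tE j jT).2 mul0r sub0r.
by rewrite mulrN.
Qed.

Lemma wedge_Omega T k : k \in T -> wedge (form1 (theta k)) (Omega T) = fun=> 0.
Proof.
elim: T => // j T IH; rewrite inE big_cons -wedgeA; case: eqVneq => [-> _|_ /= kT].
  by apply/funext => s; rewrite -[wedge _ (form1 _)](_ : (fun=> 0) = _) ?wedge0l //;
     apply/funext => t; rewrite wedge_form1_sq.
apply/funext => s; rewrite [in X in wedge X]wedge_form1C parity_form1.
by rewrite wedgeA wedgeZl IH // wedge0r mulr0.
Qed.

Lemma spinor_equations_exp T : is_form beta -> adapted T ->
  spinor_equations T (wedge (form_exp beta) (Omega T)).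
Proof.
move=> betaF adT; have [uT tL t0 t1 bE] := adT; split=> [|X|k kT].
- apply: form_wedge; first exact: form_expP.
  elim: (T) tL => [|k T' IH] tL; first by rewrite big_nil; apply: form_oneP.
  rewrite big_cons; apply: form_wedge.
    by apply: form1P; apply: tL; apply: mem_head.
  by apply: IH => j jT; apply: tL; rewrite inE jT orbT.
- have cE Y : contract Y (wedge (form_exp beta) (Omega T))
      = fun s => wedge (form1 (b Y)) (wedge (form_exp beta) (Omega T)) s
               + wedge (form_exp beta) (contract Y (Omega T)) s.
    by rewrite contract_wedge contract_exp parity_exp wedgeA.
  rewrite cE; apply/funext => s; congr (_ + _).
  rewrite (contract_Omega X adT) wedge_sumr; apply: eq_big_seq => k kT.
  rewrite cE (_ : b (E k) = fun=> 0) ?form1_0 ?wedge0l ?add0r //.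
  by apply/funext => Y; apply: (bE k kT Y).2.
- by rewrite -wedgeA wedge_form1C parity_exp wedgeA wedge_Omega //;
    apply/funext => s; rewrite wedge0r.
Qed.

(** On the list of the E k only the product of the theta k (E k) survives, as
    the E k are in the kernel of the exponent. *)
Lemma spinor_neq0 T : adapted T ->
  wedge (form_exp beta) (Omega T) [seq E k | k <- T] != 0.
Proof.
elim: T => [|k T IH] adT; first by rewrite big_nil wedge1r exp_nil oner_neq0.
have [_ tk0 tE bE] := adapted_head adT.
rewrite /= wedge_cons contract_exp parity_exp.
rewrite (_ : b (E k) = fun=> 0); last by apply/funext => Y; apply: (bE Y).2.
rewrite form1_0 (_ : wedge (fun=> 0) (form_exp beta) = fun=> 0); last first.
  by apply/funext => s; rewrite wedge0l.
rewrite wedge0l add0r contract_Omega_cons contract_Omega_E //.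
rewrite (_ : (fun s => _) = fun s => theta k (E k) * Omega T s); last first.
  by apply/funext => s; rewrite wedge0r subr0.
by rewrite wedgeZr mulf_neq0 //; apply: IH (adapted_cons adT).
Qed.

(** Contraction by E k removes theta k from the system: this anticommutes with
    the other contractions and with the other theta j, and recovers psi from
    theta k (E k) psi = theta k /\ i_{E k} psi. *)
Lemma spinor_equations_unique T psi : adapted T -> spinor_equations T psi ->
  exists c, psi = fun s => c * wedge (form_exp beta) (Omega T) s.
Proof.
elim: T psi => [|k T IH] psi adT [psiF psiC psiW].
  exists (psi [::]); rewrite big_nil wedge1r; apply: exp_unique => X.
  by rewrite psiC; apply/funext => s; rewrite big_nil addr0.
have [kT tk0 tE bE] := adapted_head adT.
have wE j X s : j \in k :: T ->
    wedge (form1 (theta j)) (contract X psi) s = theta j X * psi s.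
  move=> jT; apply/esym/eqP; rewrite -subr_eq0 -wedge_form1_cons.
  by rewrite psiW // eqxx.
have psi1E : spinor_equations T (contract (E k) psi).
  split=> [|X|j jT]; first exact: form_contract.
    rewrite form_contractC // psiC; apply/funext => s.
    rewrite {1}/contract big_cons.
    rewrite -[contract _ _ (E k :: s)]/(contract (E k) (contract (E k) psi) s).
    rewrite form_contract_sq // mulr0 add0r opprD wedge_form1_cons (bE X).1.
    rewrite mul0r sub0r opprK; congr (_ + _); rewrite -sumrN; apply: eq_bigr => j _.
    rewrite -[contract (E j) psi _]/(contract (E k) (contract (E j) psi) s).
    by rewrite form_contractC // mulrN opprK.
  apply/funext => s; rewrite wE ?(tE j jT).1 ?mul0r //.
  by rewrite inE jT orbT.
have [c psi1c] := IH _ (adapted_cons adT) psi1E.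
exists (c / theta k (E k)); apply/funext => s.
have := wE k (E k) s (mem_head _ _).
rewrite psi1c wedgeZr => /esym/(canRL (mulKf tk0)) ->.
rewrite big_cons -!wedgeA wedge_form1C parity_exp wedgeA; ring.
Qed.

Theorem spinor_line T (K : form V -> Prop) : is_form beta -> adapted T ->
  (forall psi, K psi <-> spinor_equations T psi) ->
  generates_line K (wedge (form_exp beta) (Omega T)).
Proof.
move=> betaF adT KE; split; first by eexists; apply/eqP/(spinor_neq0 adT).
move=> psi; split=> [/KE|[c ->]]; first exact: spinor_equations_unique.
exact/KE/spinor_equations_scale/spinor_equations_exp.
Qed.

End SpinorLine.

(** * Weights of sl2-triples of matrices *)

Section Ladder.
Variables (C : numFieldType) (n : nat) (D : 'M[C]_n).
Implicit Types (E F : 'M[C]_n) (v : 'rV[C]_n).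

Lemma ladder_eigen E c mu v k : E *m D - D *m E = c *: E -> v *m D = mu *: v ->
  iter k (mulmx^~ E) v *m D = (mu + k%:R * c) *: iter k (mulmx^~ E) v.
Proof.
move=> /(canRL (subrK _)) ED vD; elim: k => [|k IH]; first by rewrite mul0r addr0.
rewrite iterS -[LHS]mulmxA ED mulmxDr mulmxA IH -scalemxAl -scalemxAr -scalerDl.
by congr (_ *: _); rewrite -[k.+1]addn1 natrD; ring.
Qed.

(** The eigenvalues mu + k c are pairwise distinct, so more than n of them
    would be too many roots for the characteristic polynomial. *)
Lemma ladder_top E c mu v : c != 0 -> E *m D - D *m E = c *: E ->
  v != 0 -> v *m D = mu *: v ->
  exists k, let w := iter k (mulmx^~ E) v in
    [/\ w != 0, w *m E = 0 & w *m D = (mu + k%:R * c) *: w].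
Proof.
move=> c0 ED v0 vD.
have [k wk0] : exists k, iter k (mulmx^~ E) v == 0.
  apply/not_existsP => w0.
  pose r := [seq mu + k%:R * c | k <- iota 0 n.+1].
  suff: (size r < size (char_poly D))%N.
    by rewrite size_char_poly size_map size_iota ltnn.
  apply: max_poly_roots; first by rewrite monic_neq0 ?char_poly_monic.
    apply/allP => _ /mapP[k _ ->]; rewrite -eigenvalue_root_char.
    apply/eigenvalueP; exists (iter k (mulmx^~ E) v); last exact/negP/w0.
    exact: ladder_eigen.
  rewrite map_inj_uniq ?iota_uniq // => i j /addrI /(mulIf c0) /eqP.
  by rewrite eqr_nat => /eqP.
have := ex_minnP (ex_intro (fun k => iter k (mulmx^~ E) v == 0) k wk0).
case=> -[|m] wm0 min_m; first by rewrite (negPf v0) in wm0.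
exists m; split; [ | exact/eqP | exact: ladder_eigen].
by apply/negP => /min_m; rewrite ltnn.
Qed.

(** Climbing from v with E reaches a highest vector w of weight la. Descending
    from w with F stops after some N, and the usual formula
    F^(j+1) E = (j+1) (la - j t/2) F^j on w (matrices act on the right) forces
    la = N t/2. *)
Lemma sl2_eigenvalue_neq0 E F t mu : t != 0 ->
  E *m D - D *m E = t *: E -> F *m D - D *m F = - t *: F ->
  D = F *m E - E *m F -> eigenvalue D mu ->
  exists m : int, mu = m%:~R * (t / 2).
Proof.
move=> t0 ED FD DE /eigenvalueP[v vD v0].
have [k /= [w0 wE wD]] := ladder_top t0 ED v0 vD.
set w := iter k _ v in w0 wE wD; set la := mu + _ in wD.
have nt0 : - t != 0 by rewrite oppr_eq0.
have [N /= [u0 uF _]] := ladder_top nt0 FD w0 wD.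
have FE : F *m E = D + E *m F by rewrite DE subrK.
have step j : iter j.+1 (mulmx^~ F) w *m E
    = (j.+1%:R * (la - j%:R * (t / 2))) *: iter j (mulmx^~ F) w.
  elim: j => [|j IH]; rewrite iterS -[LHS]mulmxA FE mulmxDr mulmxA.
    by rewrite /= wE mul0mx addr0 wD mul1r mul0r subr0.
  rewrite (ladder_eigen _ FD wD) IH -scalemxAl -scalerDl; congr (_ *: _).
  by rewrite -[j.+2]addn1 -[j.+1]addn1 !natrD; field.
have := step N; rewrite iterS uF mul0mx => /esym/eqP.
rewrite scaler_eq0 (negPf u0) orbF mulf_eq0 pnatr_eq0 /= subr_eq0 => /eqP laE.
exists (N%:Z - (k.*2)%:Z); rewrite -muln2 intrB -!pmulrn natrM.
by rewrite mulrBl -laE /la; field.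
Qed.

(** E and F preserve the eigenspace of D, on which D = mu is a commutator and
    therefore has trace 0. *)
Lemma heisenberg_eigenvalue E F mu : comm_mx E D -> comm_mx F D ->
  D = F *m E - E *m F -> eigenvalue D mu -> mu = 0.
Proof.
move=> ED FD DE mu_eig.
have [P Pfree PV] : exists2 P : 'M_(\rank (eigenspace D mu), n),
    row_free P & (P :=: eigenspace D mu)%MS.
  by exists (row_base (eigenspace D mu)); [exact: row_base_free | exact: eq_row_base].
have PD : P *m D = mu *: P by apply/eigenspaceP; rewrite PV.
have stab M : comm_mx M D -> exists M', P *m M = M' *m P.
  move=> MD; apply/submxP; rewrite PV; apply/eigenspaceP.
  by rewrite -mulmxA MD mulmxA PD scalemxAl.
have [[E' PE] [F' PF]] := (stab E ED, stab F FD).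
(* E' and F' are the restrictions of E and F to the eigenspace. *)
have muE : mu%:M = F' *m E' - E' *m F'.
  apply: (row_free_inj Pfree).
  rewrite mul_scalar_mx -PD [X in P *m X]DE mulmxBr mulmxBl.
  by rewrite !mulmxA PE PF -!mulmxA PE PF.
have /eqP := congr1 mxtrace muE.
rewrite mxtrace_scalar raddfB /= (mxtrace_mulC F') subrr mulrn_eq0 mxrank_eq0.
by rewrite (negPf mu_eig) /= => /eqP.
Qed.

(** For t = 0 the three matrices satisfy the Heisenberg relations and all
    eigenvalues of D vanish. *)
Lemma sl2_eigenvalue E F t mu :
  E *m D - D *m E = t *: E -> F *m D - D *m F = - t *: F ->
  D = F *m E - E *m F -> eigenvalue D mu ->
  exists m : int, mu = m%:~R * (t / 2).
Proof.
have [->|] := eqVneq t 0; last by move=> *; apply: (@sl2_eigenvalue_neq0 E F).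
rewrite oppr0 !scale0r => /eqP; rewrite subr_eq0 => /eqP ED /eqP.
rewrite subr_eq0 => /eqP FD DE mu_eig; exists 0.
by rewrite mul0r; apply: heisenberg_eigenvalue ED FD DE mu_eig.
Qed.

End Ladder.

Lemma trace_sqr_eigenvalues (C : numClosedFieldType) n (D : 'M[C]_n) (s : C) :
  (forall mu, eigenvalue D mu -> exists m : int, mu = m%:~R * s) ->
  exists m : int, \tr (D *m D) = m%:~R * s ^+ 2.
Proof.
move=> Ds; have [|P Pu] := @cotrigonalization _ _ [:: D].
  by move=> A B; rewrite !inE => /eqP-> /eqP->.
have Pu' := unitarymx_unit Pu.
rewrite /= andbT => trigT; have [T TD] : {T | T = P *m D *m invmx P} by eexists.
have {}trigT : is_trig_mx T by move: trigT; rewrite /similar_to /= conjumx // TD.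
have DE : D = invmx P *m T *m P by rewrite TD !mulmxA mulVmx // mul1mx mulmxKV.
have TE i : exists m : int, T i i = m%:~R * s.
  apply: Ds; have : eigenvalue T (T i i).
    rewrite eigenvalue_root_char char_poly_trig // (bigD1 i) //= rootM.
    by rewrite root_XsubC eqxx.
  case/eigenvalueP => v vT v0; apply/eigenvalueP; exists (v *m P).
    by rewrite DE !mulmxA mulmxK // vT scalemxAl.
  by apply: contra v0 => /eqP vP0; rewrite -(mulmxK Pu' v) vP0 mul0mx.
pose f i := sval (cid (TE i)).
have fE i : T i i = (f i)%:~R * s by rewrite /f; case: cid.
exists (\sum_i f i ^+ 2); rewrite DE.
rewrite !mulmxA mulmxK // mxtrace_mulC !mulmxA mulmxV // mul1mx.
rewrite /mxtrace raddf_sum /= mulr_suml; apply: eq_bigr => i _.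
rewrite mxE (bigD1 i) //= big1 ?addr0 => [|j neq_ji].
  by rewrite fE rmorphXn /=; ring.
have /is_trig_mxP trig := trigT; case: (ltngtP i j) => [lt_ij|lt_ji|/val_inj eq_ij].
- by rewrite trig ?mul0r.
- by rewrite mulrC trig ?mul0r.
- by rewrite eq_ij eqxx in neq_ji.
Qed.

(** * Killing form and root vectors *)

Section Separation.
Variables (K : fieldType) (U : vectType K).

(** The values are in K^o because functionals on a Cartan subalgebra are linear
    maps into the regular module. *)
Definition basis_coord (j : 'I_(\dim {:U})) (u : U) : K^o :=
  coord (vbasis fullv) j u.

Fact basis_coord_is_linear j : linear (basis_coord j).
Proof. by move=> a u v; rewrite /basis_coord linearP. Qed.

HB.instance Definition _ j :=
  GRing.isLinear.Build K U K^o *:%R (basis_coord j) (basis_coord_is_linear j).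

Lemma functionals_separate (u : U) : (forall f : 'Hom(U, K^o), f u = 0) -> u = 0.
Proof.
move=> u0; rewrite (coord_vbasis (memvf u)) big1 // => j _.
have := u0 (linfun (basis_coord j)); rewrite lfunE /= /basis_coord => ->.
by rewrite scale0r.
Qed.

End Separation.

Section HomMatrix.
Variables (K : fieldType) (U : vectType K).
Implicit Types (f h : 'End(U)).

Lemma v2r_lfun f v : v2r (f v) = v2r v *m f2mx f.
Proof. by rewrite unlock /= r2vK. Qed.

Lemma f2mx_comp f h : f2mx (f \o h)%VF = f2mx h *m f2mx f.
Proof.
apply/row_matrixP => i; rewrite !rowE -[delta_mx 0 i]r2vK mulmxA -!v2r_lfun.
by rewrite comp_lfunE.
Qed.

Lemma f2mx_linear a f h : f2mx (a *: f + h) = a *: f2mx f + f2mx h.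
Proof.
apply/row_matrixP => i; rewrite !rowE -[delta_mx 0 i]r2vK mulmxDr -scalemxAr.
by rewrite -!v2r_lfun add_lfunE scale_lfunE linearP.
Qed.

Lemma f2mxZ a f : f2mx (a *: f) = a *: f2mx f.
Proof.
apply/row_matrixP => i; rewrite !rowE -[delta_mx 0 i]r2vK -scalemxAr.
by rewrite -!v2r_lfun scale_lfunE linearZ.
Qed.

End HomMatrix.

Section KillingForm.
Variables (K : fieldType) (g : lieAlg K).
Implicit Types (x y z : g).

Local Notation mx x := (f2mx (ad g x)).

Lemma lie_bracket_linearr a x y z :
  lie_bracket z (a *: x + y) = a *: lie_bracket z x + lie_bracket z y.
Proof. by rewrite /lie_bracket linearP. Qed.

Lemma lie_bracketZr a x z : lie_bracket z (a *: x) = a *: lie_bracket z x.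
Proof. by rewrite /lie_bracket linearZ. Qed.

Lemma lie_bracketC x y : lie_bracket x y = - lie_bracket y x.
Proof.
apply/eqP; rewrite -addr_eq0; have := ad_alternating (x + y).
rewrite /lie_bracket !linearD /= !(add_lfunE (ad g x)) /= !ad_alternating add0r addr0.
by rewrite addrC => /eqP.
Qed.

Lemma lie_bracketDr x y z : lie_bracket z (x + y) = lie_bracket z x + lie_bracket z y.
Proof. by rewrite /lie_bracket linearD. Qed.

Lemma lie_bracketNr x z : lie_bracket z (- x) = - lie_bracket z x.
Proof. by rewrite /lie_bracket linearN. Qed.

Lemma lie_bracketDl x y z : lie_bracket (x + y) z = lie_bracket x z + lie_bracket y z.
Proof. by rewrite !(lie_bracketC _ z) lie_bracketDr opprD. Qed.

Lemma lie_bracketNl x z : lie_bracket (- x) z = - lie_bracket x z.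
Proof. by rewrite !(lie_bracketC _ z) lie_bracketNr. Qed.

Lemma lie_bracketZl a x z : lie_bracket (a *: x) z = a *: lie_bracket x z.
Proof. by rewrite !(lie_bracketC _ z) lie_bracketZr scalerN. Qed.

Lemma ad_bracket x y :
  ad g (lie_bracket x y) = (ad g x \o ad g y)%VF - (ad g y \o ad g x)%VF.
Proof.
apply/lfunP => z; rewrite (add_lfunE (ad g x \o ad g y)%VF) opp_lfunE !comp_lfunE /=.
have := ad_jacobi x y z; rewrite -/(lie_bracket z x) -/(lie_bracket z (ad g x y)).
rewrite (lie_bracketC z x) (lie_bracketC z) /lie_bracket linearN /= => /eqP.
by rewrite subr_eq0 => /eqP <-.
Qed.

Lemma mxZ a x : mx (a *: x) = a *: mx x.
Proof. by rewrite (_ : ad g (a *: x) = a *: ad g x) ?f2mxZ // linearZ. Qed.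

Lemma killingE x y : killing x y = \tr (mx y *m mx x).
Proof. by rewrite /killing f2mx_comp. Qed.

Lemma killingC x y : killing x y = killing y x.
Proof. by rewrite !killingE mxtrace_mulC. Qed.

Lemma killing_linearl a x y z :
  killing (a *: x + y) z = a * killing x z + killing y z.
Proof. by rewrite !killingE linearP f2mx_linear mulmxDr -scalemxAr mxtraceD mxtraceZ. Qed.

Lemma killing_linearr a x y z :
  killing z (a *: x + y) = a * killing z x + killing z y.
Proof. by rewrite !(killingC z) killing_linearl. Qed.

Lemma mx_bracket x y : mx (lie_bracket x y) = mx y *m mx x - mx x *m mx y.
Proof.
rewrite ad_bracket -[X in f2mx X]addrC -scaleN1r f2mx_linear scaleN1r !f2mx_comp.
by rewrite addrC.
Qed.

Lemma killing_bracket x y z :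
  killing (lie_bracket x y) z = killing x (lie_bracket y z).
Proof.
rewrite !killingE !mx_bracket mulmxBl mulmxBr !mxtraceD.
rewrite ![\tr (- _)]raddfN /= !mulmxA; congr (_ - _).
by rewrite mxtrace_mulC mulmxA.
Qed.

Lemma killing0l x : killing 0 x = 0.
Proof. by have := killing_linearl (-1) x x x; rewrite scaleN1r addNr mulN1r addNr. Qed.

Lemma killingZl a x y : killing (a *: x) y = a * killing x y.
Proof. by have := killing_linearl a x 0 y; rewrite killing0l !addr0. Qed.

Lemma killingDl x y z : killing (x + y) z = killing x z + killing y z.
Proof. by have := killing_linearl 1 x y z; rewrite scale1r mul1r. Qed.

Lemma killingNl x y : killing (- x) y = - killing x y.
Proof. by rewrite -scaleN1r killingZl mulN1r. Qed.

Lemma killingZr a x y : killing x (a *: y) = a * killing x y.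
Proof. by rewrite killingC killingZl killingC. Qed.

Lemma killingDr x y z : killing z (x + y) = killing z x + killing z y.
Proof. by rewrite !(killingC z) killingDl. Qed.

Lemma killingNr x y : killing x (- y) = - killing x y.
Proof. by rewrite killingC killingNl killingC. Qed.

Section RootSpaces.
Variable h : {vspace g}.
Implicit Types (alpha beta : functional h).

Lemma killing_bracket_root alpha (u : subvs_of h) x y : in_root_space alpha x ->
  killing (vsval u) (lie_bracket x y) = (alpha u : K) * killing x y.
Proof. by move=> xa; rewrite -killing_bracket xa killingZl. Qed.

(** Invariance of the Killing form: (alpha + beta)(u) <x, y> = 0 for all u. *)
Lemma root_killing_eq0 alpha beta x y :
  in_root_space alpha x -> in_root_space beta y -> alpha + beta != 0 ->
  killing x y = 0.
Proof.
move=> xa yb /lfunPn[u]; rewrite zero_lfunE (add_lfunE alpha) => ab0.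
have : killing (vsval u) (lie_bracket x y) + killing (vsval u) (lie_bracket y x) = 0.
  by rewrite (lie_bracketC y) killingNr subrr.
rewrite (killing_bracket_root u y xa) (killing_bracket_root u x yb) (killingC y).
by rewrite -mulrDl => /eqP; rewrite mulf_eq0 (negPf ab0) => /eqP.
Qed.

(** The bracket centralizes h, and h is its own normalizer. *)
Lemma bracket_opp_root alpha x y : cartan_subalgebra h ->
  in_root_space alpha x -> in_root_space (- alpha) y -> lie_bracket x y \in h.
Proof.
move=> [_ _ norm_h] xa ya; apply: norm_h => z zh.
suff -> : lie_bracket (lie_bracket x y) z = 0 by rewrite mem0v.
rewrite lie_bracketC -{1}(vsprojK zh); set u := vsproj h z.
have := ad_jacobi (vsval u) x y; rewrite -!/(lie_bracket _ _).
rewrite [lie_bracket y (vsval u)]lie_bracketC ya xa opp_lfunE scaleNr opprK.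
rewrite !lie_bracketZr (lie_bracketC y x) scalerN.
by rewrite -addrA subrr addr0 => ->; rewrite oppr0.
Qed.

End RootSpaces.
End KillingForm.

Section FlagRoots.
Variables (R : realType) (g : lieAlg R[i]) (F : flagDatum g).
Local Notation h := (cartan F).
Local Notation X := (Xvec F).
Implicit Types (alpha beta : functional h).

Lemma root_opp alpha : is_root alpha -> is_root (- alpha).
Proof.
by have [_ rootE _ _ _] := posP F; rewrite !rootE opprK orbC.
Qed.

Lemma pos_root alpha : alpha \in pos F -> is_root alpha.
Proof. by have [_ rootE _ _ _] := posP F; rewrite rootE => ->. Qed.

Lemma Xvec_root alpha : is_root alpha -> in_root_space alpha (X alpha).
Proof. by move=> /((XvecP F).1) []. Qed.

Lemma killing_Xvec alpha : is_root alpha -> killing (X alpha) (X (- alpha)) = 1.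
Proof. by move=> /((XvecP F).1) []. Qed.

Lemma Hvec_cartan alpha : Hvec F alpha \in h.
Proof. by have [] := @HvecP _ _ F alpha. Qed.

Lemma killing_Hvec alpha (u : subvs_of h) : killing (vsval u) (Hvec F alpha) = alpha u.
Proof. by rewrite killingC; have [_ ->] := @HvecP _ _ F alpha. Qed.

(** Every functional on h is represented by some H_alpha, so a vector
    orthogonal to h is killed by all functionals. *)
Lemma cartan_nondegenerate x : x \in h ->
  (forall u : subvs_of h, killing x (vsval u) = 0) -> x = 0.
Proof.
move=> xh x0; have alpha0 alpha : alpha (vsproj h x) = 0.
  by rewrite -killing_Hvec vsprojK // -(vsprojK (Hvec_cartan alpha)) x0.
suff /(congr1 vsval) : vsproj h x = 0 by rewrite vsprojK.
exact: functionals_separate.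
Qed.

Lemma bracket_Xvec alpha : is_root alpha ->
  lie_bracket (X alpha) (X (- alpha)) = Hvec F alpha.
Proof.
move=> ra; have xa := Xvec_root ra; have ya := Xvec_root (root_opp ra).
have xyh := bracket_opp_root (cartanP F) xa ya.
apply/eqP; rewrite -subr_eq0; apply/eqP/cartan_nondegenerate.
  by rewrite memvB // Hvec_cartan.
move=> u; rewrite killingC killingDr killingNr (killing_bracket_root _ _ xa).
by rewrite killing_Xvec // mulr1 killing_Hvec subrr.
Qed.

Lemma Xvec_neq0 alpha : is_root alpha -> X alpha != 0.
Proof.
move=> ra; apply: contraTneq (oner_neq0 R[i]) => X0.
by rewrite -(killing_Xvec ra) X0 killing0l eqxx.
Qed.

Lemma bracket_cartan alpha x : is_root alpha -> x \in h ->
  lie_bracket x (X alpha) = killing x (Hvec F alpha) *: X alpha.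
Proof. by move=> ra xh; rewrite -(vsprojK xh) Xvec_root // killing_Hvec. Qed.

(** X_alpha, X_{-alpha} and H_alpha = [X_alpha, X_{-alpha}] satisfy the
    relations of an sl2-triple scaled by t = <H_alpha, H_alpha>. Since f2mx acts
    on rows, composition of endomorphisms is reversed on matrices. *)
Lemma root_eigenvalue alpha mu : is_root alpha ->
  eigenvalue (f2mx (ad g (Hvec F alpha))) mu ->
  exists m : int, mu = m%:~R * (killing (Hvec F alpha) (Hvec F alpha) / 2).
Proof.
move=> ra; have rNa := root_opp ra; have hh := Hvec_cartan alpha.
have HvecN : killing (Hvec F alpha) (Hvec F (- alpha))
    = - killing (Hvec F alpha) (Hvec F alpha).
  by rewrite -[X in killing X _](vsprojK hh) killing_Hvec opp_lfunE -killing_Hvec vsprojK.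
apply: (@sl2_eigenvalue _ _ _ (f2mx (ad g (X alpha))) (f2mx (ad g (X (- alpha))))).
- by rewrite -mx_bracket bracket_cartan // mxZ.
- by rewrite -mx_bracket bracket_cartan // mxZ HvecN.
- by rewrite -mx_bracket bracket_Xvec.
Qed.

(** beta(H_alpha) is an eigenvalue of ad H_alpha, hence an integral multiple of
    t/2 with t = <H_alpha, H_alpha>; and t = tr (ad H_alpha)^2 = n (t/2)^2
    leaves t = 0 or t = 4/n. *)
Lemma killing_Hvec_real alpha beta : is_root alpha -> is_root beta ->
  killing (Hvec F alpha) (Hvec F beta) \is Num.real.
Proof.
move=> ra rb; set t := killing (Hvec F alpha) (Hvec F alpha).
have [n tn] : exists n : int, t = n%:~R * (t / 2) ^+ 2.
  rewrite {1}/t killingE; apply: trace_sqr_eigenvalues => mu.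
  exact: root_eigenvalue.
have t_real : t \is Num.real.
  have [-> //|t0] := eqVneq t 0.
  have n0 : (n%:~R : R[i]) != 0.
    by apply: contraNneq t0 => n0; rewrite tn n0 mul0r.
  have -> : t = 4 / n%:~R.
    by apply: (mulIf t0); rewrite [in RHS]tn; field.
  by rewrite realM ?realV ?realz ?realn.
have [|m ->] := @root_eigenvalue alpha (killing (Hvec F alpha) (Hvec F beta)) ra.
  apply/eigenvalueP; exists (v2r (X beta)).
    rewrite -v2r_lfun -[ad g _ _]/(lie_bracket _ _).
    by rewrite bracket_cartan ?Hvec_cartan // linearZ.
  by apply: contra (Xvec_neq0 rb) => /eqP X0; rewrite -(v2rK (X beta)) X0 linear0.
by rewrite realM ?realz // realM ?realV ?realn.
Qed.

End FlagRoots.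

(** * The frame of the tangent space and its dual *)

Section SpanInduction.
Variables (K : fieldType) (U : vectType K) (P : U -> Prop).
Hypotheses (P0 : P 0) (PL : forall a u v, P u -> P v -> P (a *: u + v)).

Lemma span_induction (s : seq U) v : {in s, forall u, P u} -> v \in <<s>>%VS -> P v.
Proof.
move=> Ps /(@coord_span _ _ _ (in_tuple s)) ->.
apply: (big_rec P) => // i u _ Pu; apply: (PL) => //; apply: Ps.
by rewrite mem_nth.
Qed.

Lemma sumv_induction (I : eqType) (r : seq I) (W : I -> {vspace U}) v :
  {in r, forall i u, u \in W i -> P u} -> v \in (\sum_(i <- r) W i)%VS -> P v.
Proof.
elim: r v => [|i r IH] v Pr; first by rewrite big_nil memv0 => /eqP ->.
rewrite big_cons => /memv_addP[u uW [w wW ->]]; rewrite -[u]scale1r.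
apply: (PL); first by apply: Pr uW; apply: mem_head.
by apply: IH wW => j jr; apply: Pr; rewrite inE jr orbT.
Qed.

End SpanInduction.

Lemma ReZ (R : rcfType) (a : R) (z : R[i]) : complex.Re (a%:C * z) = a * complex.Re z.
Proof. by case: z => x y /=; rewrite mul0r subr0. Qed.

Lemma ReD (R : rcfType) (z w : R[i]) : complex.Re (z + w) = complex.Re z + complex.Re w.
Proof. by case: z; case: w. Qed.

Section Frame.
Variables (R : realType) (g : lieAlg R[i]) (F : flagDatum g) (H : g).
Local Notation h := (cartan F).
Local Notation X := (Xvec F).
Implicit Types (alpha beta : functional h).
Hypotheses (HT : in_torus F H) (Hreg : regular F H).

Lemma torus_cartan : H \in h.
Proof.
case: HT => Y YhR ->; apply: memvZ.
apply: (span_induction (P := fun Y : realif g => (Y : g) \in h) _ _ _ YhR).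
- exact: mem0v.
- by move=> a u v uh vh; apply: memvD => //; apply: memvZ.
- by move=> _ /mapP[alpha _ ->]; apply: Hvec_cartan.
Qed.

Lemma roots_root alpha : alpha \in roots F -> is_root alpha.
Proof.
rewrite mem_cat => /orP[/pos_root //|/mapP[beta bF ->]].
by apply: root_opp; apply: pos_root.
Qed.

(** H is i times a real combination of vectors H_beta, on which alpha is real. *)
Lemma torus_killing alpha : is_root alpha ->
  exists2 r : R, r != 0 & killing H (Hvec F alpha) = 'i * r%:C.
Proof.
move=> ra; have Hh := torus_cartan.
have Hneq0 : killing H (Hvec F alpha) != 0.
  by apply/eqP; rewrite -{1}(vsprojK Hh) killing_Hvec; apply: Hreg.
case: HT => Y YhR HY.
have : killing (Y : g) (Hvec F alpha) \is Num.real.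
  apply: (span_induction
    (P := fun Y : realif g => killing (Y : g) (Hvec F alpha) \is Num.real) _ _ _ YhR).
  - by rewrite killing0l.
  - move=> a u v u_real v_real.
    rewrite [X in X \is _](_ : _ = a%:C * killing (u : g) (Hvec F alpha)
      + killing (v : g) (Hvec F alpha)); last exact: killing_linearl.
    by rewrite realD // realM //; apply/complex_realP; exists a.
  - by move=> _ /mapP[beta /roots_root rb ->]; apply: killing_Hvec_real.
case/complex_realP => r Yr; exists r; last by rewrite HY killingZl Yr.
by apply: contraNneq Hneq0 => r0; rewrite HY killingZl Yr r0 mulr0.
Qed.

Lemma killing_bracket_Xvec alpha beta : is_root alpha -> is_root beta ->
  killing H (lie_bracket (X alpha) (X beta))
  = (alpha + beta == 0)%:R * killing H (Hvec F alpha).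
Proof.
move=> ra rb; rewrite -{1}(vsprojK torus_cartan).
rewrite (killing_bracket_root _ _ (Xvec_root ra)).
rewrite -killing_Hvec vsprojK ?torus_cartan // mulrC; congr (_ * _).
case: eqVneq => [/eqP|ab0]; last exact: (root_killing_eq0 (Xvec_root ra) (Xvec_root rb)).
by rewrite addrC addr_eq0 => /eqP ->; rewrite killing_Xvec.
Qed.

Lemma killing_HvecN alpha : killing H (Hvec F (- alpha)) = - killing H (Hvec F alpha).
Proof.
by rewrite -[H in LHS](vsprojK torus_cartan) killing_Hvec opp_lfunE -killing_Hvec
  vsprojK ?torus_cartan.
Qed.

Lemma pos_add_neq0 alpha beta : alpha \in pos F -> beta \in pos F -> alpha + beta != 0.
Proof.
have [_ _ posN _ _] := posP F; move=> /posN Na bF; rewrite addr_eq0.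
by apply: contraNneq Na => ->; rewrite opprK.
Qed.

Lemma killing_bracket_pos alpha beta : alpha \in pos F -> beta \in pos F ->
  let c := (alpha == beta)%:R * killing H (Hvec F alpha) in
  [/\ killing H (lie_bracket (X alpha) (X beta)) = 0,
      killing H (lie_bracket (X (- alpha)) (X (- beta))) = 0,
      killing H (lie_bracket (X alpha) (X (- beta))) = c &
      killing H (lie_bracket (X (- alpha)) (X beta)) = - c].
Proof.
move=> aF bF; have [ra rb] := (pos_root aF, pos_root bF).
have [rNa rNb] := (root_opp ra, root_opp rb); have ab := pos_add_neq0 aF bF.
rewrite !killing_bracket_Xvec // killing_HvecN (negPf ab) -opprD oppr_eq0 (negPf ab).
rewrite !mul0r subr_eq0 [- alpha + beta]addrC subr_eq0 [beta == _]eq_sym.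
by split=> //; rewrite mulrN.
Qed.

Lemma uspace_nminus alpha : alpha \in pos F -> (uspace alpha <= nminus F)%VS.
Proof. by move=> aF; rewrite /nminus (big_rem alpha) //= addvSl. Qed.

Lemma Atan_val alpha : alpha \in pos F -> vsval (Atan alpha) = Avec alpha.
Proof.
move=> aF; apply/vsprojK/(subvP (uspace_nminus aF))/memv_span.
exact: mem_head.
Qed.

Lemma Stan_val alpha : alpha \in pos F -> vsval (Stan alpha) = Svec alpha.
Proof.
move=> aF; apply/vsprojK/(subvP (uspace_nminus aF))/memv_span.
by rewrite !inE eqxx orbT.
Qed.

(** With alpha(H) = i r, the only nonzero values are 2 i alpha(H) = - 2 r and
    its opposite, and 2 i alpha(H) is the inverse of k_alpha. The real parts in
    the definitions lose nothing because these numbers are real. *)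
Lemma kks_frame alpha beta : alpha \in pos F -> beta \in pos F ->
  let d := (alpha == beta)%:R / kcoef H alpha in
  [/\ kks H (Atan alpha) (Atan beta) = 0,
      kks H (Atan alpha) (Stan beta) = d,
      kks H (Stan alpha) (Atan beta) = - d,
      kks H (Stan alpha) (Stan beta) = 0 & kcoef H alpha != 0].
Proof.
move=> aF bF d; have [r r0 cr] := torus_killing (pos_root aF).
have kE : kcoef H alpha = (-2 * r)^-1.
  rewrite /kcoef cr (_ : 2 * _ * _ = (-2 * r)%:C); last first.
    by rewrite mulrA -[_ * _ * 'i]mulrA -expr2 sqr_i rmorphM rmorphN /= rmorph_nat; ring.
  by rewrite -fmorphV.
have dE : d = (alpha == beta)%:R * (-2 * r) by rewrite /d kE invrK.
have [k1 k2 k3 k4] := killing_bracket_pos aF bF.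
rewrite /kks !Atan_val // !Stan_val // /Avec /Svec.
rewrite !(lie_bracketZl, lie_bracketZr, lie_bracketDl, lie_bracketNl,
  lie_bracketDr, lie_bracketNr, killingZr, killingDr, killingNr).
rewrite k1 k2 k3 k4 cr dE; have k0 : kcoef H alpha != 0.
  by rewrite kE invr_neq0 // mulf_neq0 // oppr_eq0 pnatr_eq0.
by case: (alpha == beta); rewrite ?mul1r ?mul0r; split=> //=; ring.
Qed.

(** The function inside star, given a linear structure so that linfun can be
    evaluated on it. *)
Definition star_fun alpha (Y Z : tangent F) : R^o := kcoef H alpha * kks H Y Z.

Fact star_fun_is_linear alpha Y : linear (star_fun alpha Y).
Proof.
move=> a Z W; rewrite /star_fun /kks.
have -> : lie_bracket (vsval Y : g) (vsval (a *: Z + W) : g)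
    = a%:C *: lie_bracket (vsval Y : g) (vsval Z : g)
      + lie_bracket (vsval Y : g) (vsval W : g).
  exact: lie_bracket_linearr.
by rewrite killing_linearr ReD ReZ mulrDr mulrCA.
Qed.

HB.instance Definition _ alpha Y := GRing.isLinear.Build R (tangent F) R^o *:%R
  (star_fun alpha Y) (star_fun_is_linear alpha Y).

Lemma starE alpha (Y Z : tangent F) : star H alpha Y Z = kcoef H alpha * kks H Y Z :> R.
Proof. exact: (lfunE (star_fun alpha Y)). Qed.

Lemma coframe_frame alpha beta i j : alpha \in pos F -> beta \in pos F ->
  coframe H alpha i (frame beta j) = ((alpha == beta) && (i == j))%:R :> R.
Proof.
move=> aF bF; have [AA AS SA SS k0] := kks_frame aF bF.
case: i => [[|[|//]] ?]; case: j => [[|[|//]] ?];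
  rewrite /coframe /frame /= ?opp_lfunE /Astar /Sstar starE.
- by rewrite SA mulrN opprK mulrCA divff // mulr1 andbT.
- by rewrite SS mulr0 oppr0 andbF.
- by rewrite AA mulr0 andbF.
- by rewrite AS mulrCA divff // mulr1 andbT.
Qed.

Lemma tangent_induction (P : tangent F -> Prop) : P 0 ->
  (forall a u v, P u -> P v -> P (a *: u + v)) ->
  (forall alpha j, alpha \in pos F -> P (frame alpha j)) -> forall Y, P Y.
Proof.
move=> P0 PL Pf Y; rewrite -[Y]vsvalK.
apply: (sumv_induction (P := fun v => P (vsproj (nminus F) v)) _ _ _ (subvsP Y)).
- by rewrite linear0.
- by move=> a u v Pu Pv; rewrite linearP; apply: (PL).
move=> alpha aF u; apply: (span_induction (P := fun v => P (vsproj (nminus F) v))).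
- by rewrite linear0.
- by move=> a w v Pu Pv; rewrite linearP; apply: (PL).
move=> w; rewrite !inE => /orP[] /eqP ->; first exact: (Pf alpha ord0).
exact: (Pf alpha ord_max).
Qed.

Lemma tangent_expand Y :
  Y = \sum_(alpha <- pos F) \sum_i (coframe H alpha i Y : R) *: frame alpha i.
Proof.
apply: (tangent_induction (P := fun Y =>
  Y = \sum_(alpha <- pos F) \sum_i (coframe H alpha i Y : R) *: frame alpha i)).
- by rewrite big1 // => alpha _; rewrite big1 // => i _; rewrite linear0 scale0r.
- move=> a u v {1}-> {1}->; rewrite scaler_sumr -big_split; apply: eq_bigr => alpha _ /=.
  rewrite scaler_sumr -big_split; apply: eq_bigr => i _ /=.
  by rewrite linearP scalerDl scalerA.
move=> alpha j aF; have [uF _ _ _ _] := posP F.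
rewrite (bigD1_seq alpha) //= (bigD1 j) //= coframe_frame // !eqxx scale1r.
rewrite big1 ?addr0 => [|i neq_ij]; last first.
  by rewrite coframe_frame // (negPf neq_ij) andbF scale0r.
rewrite big_seq_cond big1 ?addr0 // => beta /andP[bF neq_ab].
by rewrite big1 // => i _; rewrite coframe_frame // (negPf neq_ab) scale0r.
Qed.

Lemma gen_induction (P : gen (tangent F) -> Prop) : P 0 ->
  (forall a u v, P u -> P v -> P (a *: u + v)) ->
  (forall alpha j, alpha \in pos F -> P (gen_frame H alpha j)) -> forall u, P u.
Proof.
move=> P0 PL Pf [Y xi].
have -> : (Y, xi) = 1 *: ((Y, 0) : gen (tangent F)) + (0, xi).
  by rewrite scale1r; congr pair; rewrite /= ?addr0 ?add0r.
apply: (PL).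
  apply: (tangent_induction (P := fun Y => P (Y, 0))) => //.
    move=> a u v Pu Pv.
    have -> : (a *: u + v, 0) = a *: ((u, 0) : gen (tangent F)) + (v, 0).
      by congr pair; rewrite /= scaler0 addr0.
    exact: (PL).
  move=> alpha [[|[|//]] j2] aF; first exact: (Pf alpha 0).
  exact: (Pf alpha 1).
have -> : xi = \sum_(alpha <- pos F) \sum_i (xi (frame alpha i) : R) *: coframe H alpha i.
  apply/lfunP => Z; rewrite {1}[Z]tangent_expand linear_sum sum_lfunE.
  apply: eq_bigr => alpha _; rewrite linear_sum sum_lfunE; apply: eq_bigr => i _.
  by rewrite linearZ scale_lfunE /= [_ *: _]mulrC.
have PD u v : P (0, u) -> P (0, v) -> P (0, u + v).
  move=> Pu Pv; have -> : (0, u + v) = 1 *: ((0, u) : gen (tangent F)) + (0, v).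
    by rewrite scale1r; congr pair; rewrite /= addr0.
  exact: (PL).
rewrite big_seq; apply: (big_rec (fun xi => P (0, xi))) => // alpha u aF Pu.
apply: (PD _ _ _ Pu); apply: (big_rec (fun xi => P (0, xi))) => // i v _ Pv.
have -> : (0, (xi (frame alpha i) : R) *: coframe H alpha i + v)
   = (xi (frame alpha i) : R) *: ((0, coframe H alpha i) : gen (tangent F)) + (0, v).
  by congr pair; rewrite /= scaler0 addr0.
apply: (PL) => //; case: i => [[|[|//]] ?]; first exact: (Pf alpha 2%:R).
exact: (Pf alpha 3%:R).
Qed.

End Frame.

(** * Spinor conditions on a block *)

Section Clifford.
Variables (R : realType) (V : vectType R) (J : 'End(gen V)) (psi : form V).
Hypothesis psiF : is_form psi.
Implicit Types (u v : gen V) (s : seq V).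

Lemma covector_linear a (xi eta : dual V) :
  covector (a *: xi + eta) = fun s => a%:C * covector xi s + covector eta s.
Proof.
apply/funext => -[|X [|Y s]]; rewrite /covector /= ?mulr0 ?addr0 //.
by rewrite add_lfunE scale_lfunE rmorphD rmorphM.
Qed.

Lemma clifford_linear a u v s :
  clifford (a *: u + v) psi s = a%:C * clifford u psi s + clifford v psi s.
Proof.
rewrite /clifford covector_linear wedge_linearl (psiF.1 [::]) /=; ring.
Qed.

Lemma clifford0 s : clifford 0 psi s = 0.
Proof.
by have := clifford_linear (-1) 0 0 s; rewrite scaler0 addr0 rmorphN1 mulN1r addNr.
Qed.

Lemma cliffordN u s : clifford (- u) psi s = - clifford u psi s.
Proof.
have := clifford_linear (-1) u 0 s.
by rewrite scaleN1r addr0 rmorphN1 mulN1r clifford0 addr0.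
Qed.

Lemma clifford_sum (I : finType) (c : I -> R) (w : I -> gen V) s :
  clifford (\sum_i c i *: w i) psi s = \sum_i (c i)%:C * clifford (w i) psi s.
Proof.
elim/big_rec2: _ => [|i z u _ <-]; first exact: clifford0.
by rewrite clifford_linear.
Qed.

Lemma clifford_vector X s : clifford (X, 0) psi s = contract X psi s.
Proof.
rewrite /clifford /= (_ : covector 0 = fun=> 0) ?wedge0l ?addr0 //.
by apply/funext => -[|Y [|Z t]] //; rewrite /covector /= zero_lfunE.
Qed.

Lemma clifford_covector xi s : clifford (0, xi) psi s = wedge (covector xi) psi s.
Proof.
rewrite /clifford /= (_ : psi (0 :: s) = 0) ?add0r //.
by have := psiF.1 [::] s (-1) 0 0; rewrite /= scaler0 addr0 rmorphN1 mulN1r addNr.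
Qed.

(** The vector u - i J u of the +i-eigenspace annihilates psi. *)
Definition spinor_condition u := forall s,
  clifford u psi s = 'i * clifford (J u) psi s.

Lemma pure_spinor_lineE : (forall u, J (J u) = - u) ->
  pure_spinor_line J psi <-> forall u, spinor_condition u.
Proof.
move=> JJ; split=> [[_ Kpsi] u s|cond].
  have : in_eigenspace_i J u (- J u) by split; rewrite ?linearN ?opprK //= JJ opprK.
  by move/Kpsi/(_ s); rewrite cliffordN mulrN => /eqP; rewrite subr_eq0 => /eqP.
split=> // u v [Ju Jv] s; rewrite cond Ju cliffordN; ring.
Qed.

Lemma spinor_condition_linear a u v :
  spinor_condition u -> spinor_condition v -> spinor_condition (a *: u + v).
Proof.
move=> cu cv s; have -> : J (a *: u + v) = a *: J u + J v by rewrite linearP.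
by rewrite !clifford_linear cu cv; ring.
Qed.

End Clifford.

Section Blocks.
Variables (R : realType) (g : lieAlg R[i]) (F : flagDatum g) (H : g).
Variables (J : 'End(gen (tangent F))) (psi : form (tangent F)).
Hypothesis psiF : is_form psi.
Implicit Types alpha : functional (cartan F).

Lemma sum_ord4 (U : nmodType) (f : 'I_4 -> U) :
  \sum_i f i = f 0 + f 1 + f 2%:R + f 3%:R.
Proof.
rewrite !big_ord_recl big_ord0 addr0 !addrA.
by congr (f _ + f _ + f _ + f _); apply: val_inj.
Qed.

Lemma forall_ord4 (P : 'I_4 -> Prop) :
  (forall j, P j) <-> [/\ P 0, P 1, P 2%:R & P 3%:R].
Proof.
split=> [Pj|[P0 P1 P2 P3] j]; first by split; apply: Pj.
case: j => [[|[|[|[|//]]]] ?].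
- by rewrite (_ : Ordinal _ = 0) //; apply: val_inj.
- by rewrite (_ : Ordinal _ = 1) //; apply: val_inj.
- by rewrite (_ : Ordinal _ = 2%:R) //; apply: val_inj.
- by rewrite (_ : Ordinal _ = 3%:R) //; apply: val_inj.
Qed.

Local Notation cA alpha := (contract (Atan alpha) psi).
Local Notation cS alpha := (contract (Stan alpha) psi).
Local Notation wS alpha := (wedge (covector (- Sstar H alpha)) psi).
Local Notation wA alpha := (wedge (covector (Astar H alpha)) psi).

Lemma block_condition alpha (M : 'M[R]_4) : has_block H J alpha M ->
  (forall j, spinor_condition J psi (gen_frame H alpha j)) <->
  (forall s, let E j := 'i * ((M 0 j)%:C * cA alpha s + (M 1 j)%:C * cS alpha s
       + (M 2%:R j)%:C * wS alpha s + (M 3%:R j)%:C * wA alpha s) in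
     [/\ cA alpha s = E 0, cS alpha s = E 1, wS alpha s = E 2%:R & wA alpha s = E 3%:R]).
Proof.
move=> JM; pose Q s j := clifford (gen_frame H alpha j) psi s = 'i *
  ((M 0 j)%:C * cA alpha s + (M 1 j)%:C * cS alpha s
       + (M 2%:R j)%:C * wS alpha s + (M 3%:R j)%:C * wA alpha s).
have condE j s : clifford (gen_frame H alpha j) psi s
    = 'i * clifford (J (gen_frame H alpha j)) psi s <-> Q s j.
  by rewrite /Q JM clifford_sum // sum_ord4 !clifford_vector // !clifford_covector.
split=> [cond s|cond j s].
  have /forall_ord4[] : forall j, Q s j by move=> j; apply/condE/cond.
  by rewrite /Q !clifford_vector // !clifford_covector.
apply/condE; move: j; apply/forall_ord4; have := cond s.
by rewrite /Q !clifford_vector // !clifford_covector.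
Qed.

(** Conditions at -S^* and A^* give the two equations after multiplication by
    i; those at A and S then follow from a^2 = x y - 1, which also keeps x away
    from 0. The factor (i - a)/x is beta(A, S) for beta = B + i omega. *)
Lemma noncomplex_condition alpha a x y : noncomplex_type H J alpha a x y ->
  (forall j, spinor_condition J psi (gen_frame H alpha j)) <->
  (forall s,
     cA alpha s = ('i - a%:C) / x%:C * wA alpha s /\
     cS alpha s = - (('i - a%:C) / x%:C) * wS alpha s).
Proof.
move=> [axy JM]; rewrite (block_condition JM).
have x0 : x%:C != 0 :> R[i].
  apply/eqP => -[x0]; have := sqr_ge0 a.
  by rewrite axy x0 mul0r add0r oppr_ge0 ler10.
have ii : ('i * 'i : R[i]) = -1 by rewrite -expr2 sqr_i.
have {}axy : a%:C * a%:C = x%:C * y%:C - 1 :> R[i].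
  by rewrite -!rmorphM -expr2 axy rmorphB rmorphM rmorph1.
have pP (c w : R[i]) : c = ('i - a%:C) / x%:C * w <-> x%:C * c = ('i - a%:C) * w.
  split=> [->|E]; first by rewrite mulrA [x%:C * _]mulrC divfK.
  by apply: (mulfI x0); rewrite E mulrA [x%:C * _]mulrC divfK.
have nP (c w : R[i]) : c = - (('i - a%:C) / x%:C) * w <-> x%:C * c = - ('i - a%:C) * w.
  by rewrite !mulNr -!mulrN; apply: pP.
split=> cond s; have := cond s; rewrite /= /Jnc_mx /mx_of_rows !mxE /=;
  rewrite !(rmorph0, rmorphN) /=.
  case=> _ _ E2 E3; split; [apply/pP | apply/nP].
    have := congr1 ( *%R 'i) E3; rewrite mulrA ii => E3'.
    by rewrite mulrBl E3'; ring.
  have := congr1 ( *%R 'i) E2; rewrite mulrA ii => E2'.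
  by rewrite mulNr mulrBl E2'; ring.
move=> [/pP EA /nP ES]; split; last first.
- rewrite (_ : _ + _ + _ + _ = - (x%:C * cA alpha s) - a%:C * wA alpha s); last by ring.
  rewrite EA (_ : 'i * _ = - ('i * 'i) * wA alpha s); last by ring.
  by rewrite ii opprK mul1r.
- rewrite (_ : _ + _ + _ + _ = x%:C * cS alpha s - a%:C * wS alpha s); last by ring.
  rewrite ES (_ : 'i * _ = - ('i * 'i) * wS alpha s); last by ring.
  by rewrite ii opprK mul1r.
- apply: (mulfI x0); rewrite (_ : x%:C * ('i * _) = 'i * (a%:C * (x%:C * cS alpha s)
      - x%:C * y%:C * wS alpha s)); last by ring.
  rewrite ES (_ : x%:C * y%:C = a%:C * a%:C + 1); last by rewrite axy subrK.
  rewrite (_ : 'i * _ = (- ('i * 'i) * a%:C - 'i) * wS alpha s); last by ring.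
  by rewrite ii; ring.
- apply: (mulfI x0); rewrite (_ : x%:C * ('i * _) = 'i * (a%:C * (x%:C * cA alpha s)
      + x%:C * y%:C * wA alpha s)); last by ring.
  rewrite EA (_ : x%:C * y%:C = a%:C * a%:C + 1); last by rewrite axy subrK.
  rewrite (_ : 'i * _ = (('i * 'i) * a%:C + 'i) * wA alpha s); last by ring.
  by rewrite ii; ring.
Qed.

(** The sign e distinguishes the two structures of complex type. *)
Lemma complex_condition alpha (e : R) :
  e ^+ 2 = 1 -> has_block H J alpha (e *: J0_mx R) ->
  (forall j, spinor_condition J psi (gen_frame H alpha j)) <->
  (forall s,
     cS alpha s = - ('i * e%:C) * cA alpha s /\
     wS alpha s = 'i * e%:C * wA alpha s).
Proof.
move=> e2 JM; rewrite (block_condition JM).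
have ii : ('i * 'i : R[i]) = -1 by rewrite -expr2 sqr_i.
have {}e2 : e%:C * e%:C = 1 :> R[i] by rewrite -rmorphM -expr2 e2 rmorph1.
split=> cond s; have := cond s; rewrite /= /J0_mx /mx_of_rows !mxE /=;
  rewrite !(mulr0, mulr1, mulrN) !(rmorph0, rmorphN) /=.
  by case=> _ ES EwS _; split; [rewrite {1}ES | rewrite {1}EwS]; ring.
case=> ES EwS; have iie : - ('i * 'i) * (e%:C * e%:C) = 1 :> R[i] by rewrite ii e2; ring.
split; rewrite ?ES ?EwS; try ring.
  by rewrite -[LHS]mul1r -iie; ring.
by rewrite -[LHS]mul1r -iie; ring.
Qed.

End Blocks.

(** * From the spinor line to the linear system *)

Section Assembly.
Variables (R : realType) (g : lieAlg R[i]) (F : flagDatum g) (H : g).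
Variables (J : 'End(gen (tangent F))) (Tnc Tc : seq (functional (cartan F))).
Variables (a x y : functional (cartan F) -> R).
Variable Omega : functional (cartan F) -> tangent F -> R[i].
Implicit Types (alpha beta : functional (cartan F)) (Y Z : tangent F).
Hypotheses (HT : in_torus F H) (Hreg : regular F H).

Lemma eq_on_frames (f1 f2 : tangent F -> R[i]) :
  (forall (r : R) Y Z, f1 (r *: Y + Z) = r%:C * f1 Y + f1 Z) ->
  (forall (r : R) Y Z, f2 (r *: Y + Z) = r%:C * f2 Y + f2 Z) ->
  (forall alpha j, alpha \in pos F -> f1 (frame alpha j) = f2 (frame alpha j)) ->
  f1 =1 f2.
Proof.
have f0 (f : tangent F -> R[i]) :
    (forall (r : R) Y Z, f (r *: Y + Z) = r%:C * f Y + f Z) -> f 0 = 0.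
  by move=> fL; have := fL (-1) 0 0; rewrite scaler0 addr0 rmorphN1 mulN1r addNr.
move=> f1L f2L f12; apply: tangent_induction => //; first by rewrite !f0.
by move=> r u v uE vE; rewrite f1L f2L uE vE.
Qed.

Local Notation cf alpha i Y := ((coframe H alpha i Y : R)%:C).

Lemma cf_linear alpha i (r : R) Y Z :
  cf alpha i (r *: Y + Z) = r%:C * cf alpha i Y + cf alpha i Z.
Proof. by rewrite linearP rmorphD rmorphM. Qed.

Lemma cf_frame alpha beta i j : alpha \in pos F -> beta \in pos F ->
  cf alpha i (frame beta j) = ((alpha == beta) && (i == j))%:R.
Proof. by move=> aF bF; rewrite coframe_frame // rmorph_nat. Qed.

(** The value of B_alpha + i omega_alpha on (A_alpha, S_alpha), once turned into
    a 2-form by the matrix convention. *)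
Definition block_coef alpha : R[i] := ('i - (a alpha)%:C) / (x alpha)%:C.

Definition exponent Y Z : R[i] := \sum_(alpha <- Tnc)
  block_coef alpha * (cf alpha 0 Y * cf alpha 1 Z - cf alpha 1 Y * cf alpha 0 Z).

Lemma exponent_form : is_form (form2 exponent).
Proof.
apply: form2P => [r u v w|r u v w|u]; rewrite /exponent.
- rewrite mulr_sumr -big_split; apply: eq_bigr => alpha _ /=.
  rewrite !cf_linear; ring.
- rewrite mulr_sumr -big_split; apply: eq_bigr => alpha _ /=.
  rewrite !cf_linear; ring.
- by rewrite big1 // => alpha _; ring.
Qed.

Lemma exponentC Y Z : exponent Y Z = - exponent Z Y.
Proof. by rewrite -sumrN; apply: eq_bigr => alpha _; ring. Qed.

Lemma sum_ord2 (U : nmodType) (f : 'I_2 -> U) : \sum_i f i = f 0 + f 1.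
Proof.
by rewrite !big_ord_recl big_ord0 addr0; congr (f _ + f _); apply: val_inj.
Qed.

(** Both Gram matrices are antisymmetric, with entry - a/x for B_alpha and 1/x
    for omega_alpha in row S_alpha, column A_alpha; block_form reads that entry
    as the value on (A_alpha, S_alpha). *)
Lemma block_form_sum alpha : alpha \in pos F -> forall s,
  block_form H alpha (gram_mx alpha (Bform H alpha (a alpha) (x alpha))) s +
  'i * block_form H alpha (gram_mx alpha (omegaform H alpha (x alpha))) s
  = form2 (fun Y Z => block_coef alpha *
      (cf alpha 0 Y * cf alpha 1 Z - cf alpha 1 Y * cf alpha 0 Z)) s.
Proof.
move=> aF; have [AA AS SA SS k0] := kks_frame HT Hreg aF aF.
have covS Y : (Sstar H alpha Y : R) = - (coframe H alpha 0 Y : R).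
  by rewrite /coframe /= opp_lfunE opprK.
have gramB i j : gram_mx alpha (Bform H alpha (a alpha) (x alpha)) i j
    = (- (a alpha / x alpha))%:C * ((i == 1) && (j == 0))%:R
      + (a alpha / x alpha)%:C * ((i == 0) && (j == 1))%:R.
  rewrite mxE /Bform wedge_form1_form1 !covS.
  rewrite -[Astar H alpha]/(coframe H alpha 1) !coframe_frame // eqxx.
  by case: i => [[|[|//]] ?]; case: j => [[|[|//]] ?] /=;
    rewrite !(rmorphN, rmorph0, rmorph1) /=; ring.
have gramw i j : gram_mx alpha (omegaform H alpha (x alpha)) i j
    = (x alpha)^-1%:C * ((i == 1) && (j == 0))%:R
      - (x alpha)^-1%:C * ((i == 0) && (j == 1))%:R.
  rewrite mxE /omegaform /= /frame.
  have kx r : - (kcoef H alpha / x alpha) * (r / kcoef H alpha) = - (r / x alpha).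
    rewrite mulNr (_ : _ / _ * _ = r / x alpha * (kcoef H alpha / kcoef H alpha)).
      by rewrite divff // mulr1.
    by ring.
  by case: i => [[|[|//]] ?]; case: j => [[|[|//]] ?] /=;
    rewrite ?AA ?AS ?SA ?SS ?eqxx ?mulr0 ?mulrN ?kx ?mul1r ?(rmorphN, rmorph0) /=; ring.
move=> [|Y [|Z [|W s]]] /=; rewrite ?mulr0 ?addr0 //.
rewrite /block_form /= !sum_ord2 !gramB !gramw /= /block_coef.
rewrite !(rmorphN, rmorphM, fmorphV) /=; ring.
Qed.

Hypotheses (perm_pos : perm_eq (pos F) (Tnc ++ Tc)).
Hypotheses (Jnc : forall alpha, alpha \in Tnc ->
  noncomplex_type H J alpha (a alpha) (x alpha) (y alpha)).
Hypotheses (Jc : forall alpha, alpha \in Tc -> complex_type H J alpha).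
Hypotheses (Om : forall alpha, alpha \in Tc -> is_form10 J alpha (Omega alpha)).

Lemma mem_pos alpha : (alpha \in pos F) = (alpha \in Tnc) || (alpha \in Tc).
Proof. by rewrite (perm_mem perm_pos) mem_cat. Qed.

Lemma uniq_parts : [/\ uniq Tnc, uniq Tc & {in Tnc, forall alpha, alpha \notin Tc}].
Proof.
have [uF _ _ _ _] := posP F; move: uF; rewrite (perm_uniq perm_pos) cat_uniq.
case/and3P=> un /hasPn nc uc; split=> // alpha aT.
by apply: contraL aT; apply: nc.
Qed.

Lemma exponentE : (fun s => \sum_(alpha <- Tnc)
    (block_form H alpha (gram_mx alpha (Bform H alpha (a alpha) (x alpha))) s +
     'i * block_form H alpha (gram_mx alpha (omegaform H alpha (x alpha))) s))
  = form2 exponent.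
Proof.
apply/funext => s; transitivity (\sum_(alpha <- Tnc) form2 (fun Y Z => block_coef alpha *
    (cf alpha 0 Y * cf alpha 1 Z - cf alpha 1 Y * cf alpha 0 Z)) s).
  by apply: eq_big_seq => alpha aT; apply: block_form_sum; rewrite mem_pos aT.
by case: s => [|Y [|Z [|W s]]] /=; rewrite ?big1_eq.
Qed.

Lemma exponent_frame beta Z : beta \in pos F ->
  exponent (Atan beta) Z = (beta \in Tnc)%:R * (block_coef beta * cf beta 1 Z) /\
  exponent (Stan beta) Z = (beta \in Tnc)%:R * (- block_coef beta * cf beta 0 Z).
Proof.
move=> bF; have [un _ _] := uniq_parts.
have sF alpha : alpha \in Tnc -> alpha \in pos F by rewrite mem_pos => ->.
have expE j : exponent (frame beta j) Z = (beta \in Tnc)%:R * (block_coef beta *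
    ((0 == j)%:R * cf beta 1 Z - (1 == j)%:R * cf beta 0 Z)).
  rewrite /exponent; have [bT|bT] := boolP (beta \in Tnc); last first.
    rewrite mul0r big_seq big1 // => alpha aT.
    have ab : alpha != beta by apply: contraNneq bT => <-.
    by rewrite !(cf_frame _ _ (sF _ aT) bF) (negPf ab) /=; ring.
  rewrite (bigD1_seq beta) //= !cf_frame // eqxx /= mul1r big_seq_cond big1 ?addr0 //.
  move=> alpha /andP[aT ab].
  by rewrite !(cf_frame _ _ (sF _ aT) bF) (negPf ab) /=; ring.
split; [rewrite -[Atan beta]/(frame beta 0) | rewrite -[Stan beta]/(frame beta 1)];
  by rewrite expE /=; ring.
Qed.

Lemma Omega_linear alpha : alpha \in Tc -> forall (r : R) Y Z,
  Omega alpha (r *: Y + Z) = r%:C * Omega alpha Y + Omega alpha Z.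
Proof. by case/Om. Qed.

Lemma frame_uspace beta j : beta \in pos F -> vsval (frame beta j) \in uspace beta.
Proof.
move=> bF; case: j => [[|[|//]] ?]; rewrite /frame /= ?Atan_val // ?Stan_val //.
  by apply: memv_span; apply: mem_head.
by apply: memv_span; rewrite !inE eqxx orbT.
Qed.

Lemma Omega_frame_neq alpha beta j : alpha \in Tc -> beta \in pos F ->
  beta != alpha -> Omega alpha (frame beta j) = 0.
Proof. by move=> /Om[_ Om0 _ _] bF ba; apply: Om0 bF ba (frame_uspace j bF). Qed.

(** The upper left block of J is - I, so that I A = - e S and
    theta(I A) = i theta(A) gives theta(S) = - i e theta(A). *)
Lemma complex_sign alpha : alpha \in Tc -> exists e : R,
  [/\ e ^+ 2 = 1, has_block H J alpha (e *: J0_mx R) &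
      forall Y, Omega alpha Y
        = Omega alpha (Atan alpha) * (cf alpha 0 Y - 'i * e%:C * cf alpha 1 Y)].
Proof.
move=> aT; have aF : alpha \in pos F by rewrite mem_pos aT orbT.
have [e [e2 Je]] : exists e : R, e ^+ 2 = 1 /\ has_block H J alpha (e *: J0_mx R).
  case: (Jc aT) => J0; [exists 1 | exists (-1)].
    by rewrite expr1n scale1r.
  by rewrite sqrrN expr1n scaleN1r.
exists e; split=> //; have [_ _ Om10 _] := Om aT; have OmL := Omega_linear aT.
have JA : cpx_struct J (Atan alpha) = (- e) *: Stan alpha + 0.
  rewrite /cpx_struct -[(_, 0)]/(gen_frame H alpha 0) Je sum_ord4 !mxE /=.
  by rewrite ?mulr0 ?mulr1 ?scale0r ?add0r ?addr0 scaleNr.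
have Om0 : Omega alpha 0 = 0.
  by have := OmL (-1) 0 0; rewrite scaler0 addr0 rmorphN1 mulN1r addNr.
have := Om10 _ (frame_uspace 0 aF); rewrite [frame _ _]/= JA OmL Om0 addr0 => OmS.
have {}OmS : Omega alpha (Stan alpha) = - ('i * e%:C) * Omega alpha (Atan alpha).
  have e2C : e%:C * e%:C = 1 :> R[i] by rewrite -rmorphM -expr2 e2 rmorph1.
  have eS : e%:C * Omega alpha (Stan alpha) = - ('i * Omega alpha (Atan alpha)).
    by rewrite -OmS rmorphN; ring.
  by rewrite -[LHS]mul1r -e2C -mulrA eS; ring.
apply: eq_on_frames => [//|r Y Z|beta j bF].
  by rewrite !cf_linear; ring.
rewrite !cf_frame //; have [<-|ab] := eqVneq alpha beta; last first.
  by rewrite Omega_frame_neq 1?eq_sym //=; ring.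
by case: j => [[|[|//]] ?] /=; rewrite /frame /= ?OmS; ring.
Qed.

Lemma Omega_Atan_neq0 alpha : alpha \in Tc -> Omega alpha (Atan alpha) != 0.
Proof.
move=> aT; have [e [_ _ OmE]] := complex_sign aT; have [_ _ _ [Y OmY]] := Om aT.
by apply/eqP => OmA; apply: OmY; rewrite OmE OmA mul0r.
Qed.

Lemma adapted_Omega : adapted exponent Omega (@Atan R g F) Tc.
Proof.
have [un uc nc] := uniq_parts.
have cF alpha : alpha \in Tc -> alpha \in pos F by rewrite mem_pos orbC => ->.
have cN alpha : alpha \in Tc -> (alpha \in Tnc) = false.
  by move=> aT; apply/negP => /nc; rewrite aT.
split=> // [alpha aT|alpha aT|alpha beta aT bT ab|alpha aT Y].
- exact: Omega_linear.
- exact: Omega_Atan_neq0.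
- by apply: (Omega_frame_neq 0) => //; [apply: cF | rewrite eq_sym].
have expA : exponent (Atan alpha) Y = 0.
  by rewrite (exponent_frame _ (cF _ aT)).1 cN // mul0r.
by split=> //; rewrite exponentC expA oppr0.
Qed.

(** Both systems are compared on the frame: at a noncomplex root only the
    exponent contributes, at a complex root only the corresponding Omega. *)
Lemma spinor_conditionsE psi : is_form psi ->
  (forall alpha j, alpha \in pos F -> spinor_condition J psi (gen_frame H alpha j)) <->
  spinor_equations exponent Omega (@Atan R g F) Tc psi.
Proof.
move=> psiF; have [un uc nc] := uniq_parts.
have wedge_exp beta s : beta \in pos F ->
    wedge (form1 (exponent (Atan beta))) psi s
    = (beta \in Tnc)%:R * (block_coef beta * wedge (covector (Astar H beta)) psi s) /\
    wedge (form1 (exponent (Stan beta))) psi s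
    = (beta \in Tnc)%:R * (- block_coef beta * wedge (covector (- Sstar H beta)) psi s).
  move=> bF; split.
    rewrite -!wedgeZl; congr (wedge _ _ _); apply/funext => -[|Z [|W t]] /=;
      rewrite ?mulr0 //; exact: (exponent_frame _ bF).1.
  rewrite -!wedgeZl; congr (wedge _ _ _); apply/funext => -[|Z [|W t]] /=;
    rewrite ?mulr0 //; exact: (exponent_frame _ bF).2.
have sum_Omega beta j s : beta \in pos F ->
    \sum_(k <- Tc) Omega k (frame beta j) / Omega k (Atan k) * contract (Atan k) psi s
    = (beta \in Tc)%:R * (Omega beta (frame beta j) / Omega beta (Atan beta)
        * contract (Atan beta) psi s).
  move=> bF; have [bT|bT] := boolP (beta \in Tc); last first.
    rewrite mul0r big_seq big1 // => k kT; rewrite Omega_frame_neq ?mul0r //.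
    by apply: contraNneq bT => ->.
  rewrite (bigD1_seq beta) //= mul1r big_seq_cond big1 ?addr0 // => k /andP[kT kb].
  by rewrite Omega_frame_neq ?mul0r // eq_sym.
have wedge_Om alpha e s : (forall Y, Omega alpha Y
        = Omega alpha (Atan alpha) * (cf alpha 0 Y - 'i * e%:C * cf alpha 1 Y)) ->
    wedge (form1 (Omega alpha)) psi s = Omega alpha (Atan alpha) *
      (- ('i * e%:C) * wedge (covector (Astar H alpha)) psi s
       + wedge (covector (- Sstar H alpha)) psi s).
  move=> OmE; rewrite -wedge_linearl -wedgeZl; congr (wedge _ _ _).
  apply/funext => -[|Z [|W t]] /=; rewrite ?mulr0 ?addr0 ?mulr0 //.
  by rewrite OmE; congr (_ * _); rewrite addrC mulNr.
have OmS alpha e : alpha \in Tc -> (forall Y, Omega alpha Y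
        = Omega alpha (Atan alpha) * (cf alpha 0 Y - 'i * e%:C * cf alpha 1 Y)) ->
    Omega alpha (frame alpha 1) / Omega alpha (Atan alpha) = - ('i * e%:C).
  move=> aT OmE; have aF : alpha \in pos F by rewrite mem_pos aT orbT.
  rewrite OmE mulrAC divff ?Omega_Atan_neq0 // !cf_frame // eqxx /=; ring.
split=> [cond|[_ eqC eqW] alpha j aF].
  split=> // [X|alpha aT]; last first.
    apply/funext => s; have [e [e2 Je OmE]] := complex_sign aT.
    have aF : alpha \in pos F by rewrite mem_pos aT orbT.
    have /(complex_condition psiF e2 Je)/(_ s)[_ wS] := fun j => cond alpha j aF.
    by rewrite (wedge_Om _ _ _ OmE) wS; ring.
  apply/funext => s; move: X; apply: eq_on_frames => [r Y Z|r Y Z|beta j bF].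
  - exact: (psiF.1 [::]).
  - have expL : form1 (exponent (r *: Y + Z)) = fun t =>
        r%:C * form1 (exponent Y) t + form1 (exponent Z) t.
      apply/funext => -[|W [|W' t]] /=; rewrite ?mulr0 ?addr0 //.
      exact: (exponent_form.1 [::] [:: W]).
    rewrite expL wedge_linearl mulrDr mulr_sumr addrACA -big_split; congr (_ + _).
    apply: eq_big_seq => k kT /=; rewrite Omega_linear //; ring.
  rewrite sum_Omega //; move: bF (bF); rewrite {1}mem_pos => /orP[bT|bT] bF.
    have /(noncomplex_condition psiF (Jnc bT))/(_ s)[cA cS] := fun j => cond beta j bF.
    rewrite (negPf (nc _ bT)) mul0r addr0.
    case: j => [[|[|//]] ?]; rewrite [frame _ _]/=.
      by rewrite (wedge_exp _ _ bF).1 bT mul1r cA.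
    by rewrite (wedge_exp _ _ bF).2 bT mul1r cS.
  have bN : (beta \in Tnc) = false by apply/negP => /nc; rewrite bT.
  have [e [e2 Je OmE]] := complex_sign bT.
  have /(complex_condition psiF e2 Je)/(_ s)[cS _] := fun j => cond beta j bF.
  rewrite bT mul1r; case: j => [[|[|//]] ?].
    rewrite [frame _ _]/= (wedge_exp _ _ bF).1 bN mul0r add0r.
    by rewrite divff ?mul1r // Omega_Atan_neq0.
  rewrite (_ : Ordinal _ = 1); last exact: val_inj.
  by rewrite (OmS _ _ bT OmE) [frame _ _]/= (wedge_exp _ _ bF).2 bN mul0r add0r cS.
have eqF s k : contract (frame alpha k) psi s
    = wedge (form1 (exponent (frame alpha k))) psi s + (alpha \in Tc)%:R *
      (Omega alpha (frame alpha k) / Omega alpha (Atan alpha)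
        * contract (Atan alpha) psi s).
  by rewrite {1}eqC sum_Omega.
move: aF (aF); rewrite {1}mem_pos => /orP[aT|aT] aF.
  move: j; apply/(noncomplex_condition psiF (Jnc aT)) => s.
  have := eqF s 0; have := eqF s 1; rewrite (negPf (nc _ aT)) !mul0r !addr0 [frame _ _]/=.
  rewrite [frame _ _]/= (wedge_exp _ _ aF).1 (wedge_exp _ _ aF).2 aT !mul1r.
  by move=> cS cA; split.
have aN : (alpha \in Tnc) = false by apply/negP => /nc; rewrite aT.
have [e [e2 Je OmE]] := complex_sign aT.
move: j; apply/(complex_condition psiF e2 Je) => s; split.
  have := eqF s 1; rewrite (OmS _ _ aT OmE) aT mul1r [frame _ _]/=.
  by rewrite (wedge_exp _ _ aF).2 aN mul0r add0r.
have /(congr1 (fun f => f s)) := eqW _ aT.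
rewrite (wedge_Om _ _ _ OmE) => /eqP; rewrite mulf_eq0 (negPf (Omega_Atan_neq0 aT)) /=.
by rewrite addrC mulNr subr_eq0 => /eqP.
Qed.

End Assembly.

Theorem proposition5p24 (R : realType) (g : lieAlg R[i]) (F : flagDatum g)
    (H : g) (J : 'End(gen (tangent F)))
    (Tnc Tc : seq (functional (cartan F)))
    (a x y : functional (cartan F) -> R)
    (Omega : functional (cartan F) -> tangent F -> R[i]) :
  semisimple g ->
  in_torus F H -> regular F H ->
  invariant_gacs J ->
  perm_eq (pos F) (Tnc ++ Tc) ->
  (forall alpha, alpha \in Tnc ->
     noncomplex_type H J alpha (a alpha) (x alpha) (y alpha)) ->
  (forall alpha, alpha \in Tc -> complex_type H J alpha) ->
  (forall alpha, alpha \in Tc -> is_form10 J alpha (Omega alpha)) ->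
  generates_line (pure_spinor_line J) (spinor H Tnc Tc a x Omega).
Proof.
move=> _ HT Hreg [[_ JJ] _] perm_pos Jnc Jc Om.
rewrite /spinor (exponentE a x HT Hreg perm_pos).
apply: (spinor_line (E := @Atan R g F)).
- exact: exponent_form.
- exact: adapted_Omega HT Hreg perm_pos Jc Om.
move=> psi.
split=> [Kpsi|eqs].
  have psiF := Kpsi.1; apply/(spinor_conditionsE HT Hreg perm_pos Jnc Jc Om psiF).
  by move=> alpha j _; move/(pure_spinor_lineE psiF JJ): Kpsi; apply.
have [psiF _ _] := eqs; apply/(pure_spinor_lineE psiF JJ).
move/(spinor_conditionsE HT Hreg perm_pos Jnc Jc Om psiF): eqs => cond.
apply: (gen_induction HT Hreg) => //.
- move=> s; rewrite linear0 clifford0 //; ring.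
- by move=> r u v; apply: spinor_condition_linear.
Qed.
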